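(* Let $\Gamma$ be a finite Coxeter graph each of whose connected components is a tree all of whose edge labels are odd. Then every Coxeter group $W$ with $\widehat W\cong\widehat{W_\Gamma}$ is isomorphic to $W_\Gamma$.
   Context: For a finite simplicial graph $\Gamma$ with edge labels $m\colon E(\Gamma)\to\mathbb{N}_{\ge2}$, $W_\Gamma=\langle V(\Gamma)\mid v^2,\ (vw)^{m(\{v,w\})}\text{ for }\{v,w\}\in E(\Gamma)\rangle$. $\widehat{G}$ is profinite completion. *)

(* Defs.v *)
From Stdlib Require Import List.
From mathcomp Require Import all_boot.

Set Implicit Arguments.
Unset Strict Implicit.
Unset Printing Implicit Defensive.

Record Grp := MkGrp {
  gcar :> Type;
  gmul : gcar -> gcar -> gcar;
  gone : gcar;
  ginv : gcar -> gcar;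
  gmulA : forall x y z, gmul x (gmul y z) = gmul (gmul x y) z;
  gmul1g : forall x, gmul gone x = x;
  gmulVg : forall x, gmul (ginv x) x = gone
}.

Arguments gmul {g}.
Arguments gone {g}.
Arguments ginv {g}.

Fixpoint gpow (G : Grp) (x : G) (n : nat) : G :=
  match n with 0 => gone | S k => gmul x (gpow x k) end.

Definition is_hom (G H : Grp) (f : G -> H) : Prop :=
  forall x y, f (gmul x y) = gmul (f x) (f y).

Definition grp_iso (G H : Grp) : Prop :=
  exists (f : G -> H) (g : H -> G),
    is_hom f /\ is_hom g /\ (forall x, g (f x) = x) /\ (forall y, f (g y) = y).

Definition normal_subgroup (G : Grp) (N : G -> Prop) : Prop :=
  N gone /\ (forall x y, N x -> N y -> N (gmul x (ginv y))) /\
  (forall g x, N x -> N (gmul (ginv g) (gmul x g))).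

Definition finite_index (G : Grp) (N : G -> Prop) : Prop :=
  exists reps : list G, forall x, exists r, In r reps /\ N (gmul (ginv r) x).

Definition FNS (G : Grp) : Type :=
  { N : G -> Prop | normal_subgroup N /\ finite_index N }.

(* An element of the profinite completion  \hat G = lim_{N} G/N  is a compatible
   family of cosets, each coset x N being represented by an element of G. *)
Record compl (G : Grp) := MkCompl {
  cf : FNS G -> G;
  ccompat : forall N M : FNS G,
      (forall x, proj1_sig N x -> proj1_sig M x) ->
      proj1_sig M (gmul (ginv (cf M)) (cf N))
}.

Definition cagree (G : Grp) (N : FNS G) (x y : compl G) : Prop :=
  proj1_sig N (gmul (ginv (cf x N)) (cf y N)).

Definition ceq (G : Grp) (x y : compl G) : Prop := forall N, cagree N x y.

Definition cprod (G : Grp) (x y z : compl G) : Prop :=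
  forall N : FNS G, proj1_sig N (gmul (ginv (cf z N)) (gmul (cf x N) (cf y N))).

Definition ccont (G H : Grp) (f : compl G -> compl H) : Prop :=
  forall M : FNS H, exists N : FNS G,
    forall x y, cagree N x y -> cagree M (f x) (f y).

Definition chom (G H : Grp) (f : compl G -> compl H) : Prop :=
  (forall x y, ceq x y -> ceq (f x) (f y)) /\
  (forall x y z, cprod x y z -> cprod (f x) (f y) (f z)) /\
  ccont f.

Definition compl_iso (G H : Grp) : Prop :=
  exists (f : compl G -> compl H) (g : compl H -> compl G),
    chom f /\ chom g /\ (forall x, ceq (g (f x)) x) /\ (forall y, ceq (f (g y)) y).

Definition coxeter_graph (V : finType) (adj : rel V) (m : V -> V -> nat) : Prop :=
  (forall v w, adj v w = adj w v) /\ (forall v, ~~ adj v v) /\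
  (forall v w, adj v w -> m v w = m w v) /\
  (forall v w, adj v w -> 2 <= m v w).

Definition coxeter_relations (V : finType) (adj : rel V) (m : V -> V -> nat)
    (H : Grp) (t : V -> H) : Prop :=
  (forall v, gmul (t v) (t v) = gone) /\
  (forall v w, adj v w -> gpow (gmul (t v) (t w)) (m v w) = gone).

Definition coxeter_presentation (V : finType) (adj : rel V) (m : V -> V -> nat)
    (G : Grp) (s : V -> G) : Prop :=
  coxeter_relations adj m s /\
  (forall x : G, exists l : seq V, x = foldr (fun v acc => gmul (s v) acc) gone l) /\
  (forall (H : Grp) (t : V -> H), coxeter_relations adj m t ->
     exists f : G -> H, is_hom f /\ forall v, f (s v) = t v).

Definition is_W (V : finType) (adj : rel V) (m : V -> V -> nat) (G : Grp) : Prop :=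
  exists s : V -> G, coxeter_presentation adj m s.

Definition coxeter_group (G : Grp) : Prop :=
  exists (V : finType) (adj : rel V) (m : V -> V -> nat),
    coxeter_graph adj m /\ is_W adj m G.

Definition forest (V : finType) (adj : rel V) : Prop :=
  forall p : seq V, uniq p -> 3 <= size p -> ~~ cycle adj p.

Definition odd_labels (V : finType) (adj : rel V) (m : V -> V -> nat) : Prop :=
  forall v w, adj v w -> odd (m v w).

(* Main.v *)
(* Groups with topologically isomorphic profinite completions have the same
   homomorphisms to finite groups, naturally in the target. For W_Gamma these are easy
   to control. All reflections of a component of Gamma are conjugate, and conjugating
   generators turns every component into a star with the same labels; so W_Gamma is a
   free product of amalgams of odd dihedral groups over Z/2, and

   (1) if E -> B is a surjection of finite groups with kernel of exponent prime to the
       labels, W_Gamma -> B lifts to E as soon as the images of the generators lift to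
       involutions.

   Let W be a Coxeter group with the same completion; it inherits (1).
   - W has no even label. Otherwise it has a Klein four-subgroup (visible in a finite
     reflection representation), hence an involution x on which the character sending
     all generators of W_Gamma to -1 is trivial. So x is not conjugate to a generator
     of W_Gamma in a finite quotient Q, generators act freely on the cosets of <x>, and
     (1) with kernel of exponent 2 applies to the wreath product extension induced from
     Z/4 -> Z/2 over <x>; but x does not lift to an involution.
   - The graph of W has no cycle. Given a chordless one, a suitable finite reflection
     representation of W has a subquotient on which the generators of the cycle act by
     affine reflections of a plane in odd characteristic p, prime to all labels, all of
     the lines but one passing through a common point. The Heisenberg extension of the
     affine group is central up to sign and has kernel of order p; the cycle does not
     lift to it, the obstruction being the area of the polygon cut out by the lines.
     Inducing to W by a wreath product contradicts (1).
   - So W is given by stars too, and counting homomorphisms to affine dihedral groups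
     L^2 : (mu_N : 2) lying over a given sign character yields, for the characters
     supported on one star, the values at |L| of X * prod (1 + (m - 1) X), m ranging
     over the labels of the star; this polynomial determines the labels. *)
From HB Require Import structures.
From Stdlib Require Import List IndefiniteDescription Classical.
From mathcomp Require Import all_boot all_algebra all_fingroup cyclic all_field.
From mathcomp Require Import ring zify.
Require Import Defs.

Set Implicit Arguments.
Unset Strict Implicit.
Unset Printing Implicit Defensive.
Import GRing.Theory.

(** * Finite quotients and the profinite completion *)

Section GrpTheory.
Variable G : Grp.
Implicit Types x y z : G.

Lemma gmulI x y z : gmul x y = gmul x z -> y = z.
Proof. by move=> /(congr1 (gmul (ginv x))); rewrite !gmulA !gmulVg !gmul1g. Qed.

Lemma gmulgV x : gmul x (ginv x) = gone.
Proof.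
rewrite -(gmulVg (ginv x)) -{1}(gmul1g x) -{1}(gmulVg (ginv x)).
by rewrite -!gmulA [gmul (ginv x) (gmul x _)]gmulA gmulVg gmul1g.
Qed.

Lemma gmulg1 x : gmul x gone = x.
Proof. by rewrite -(gmulVg x) gmulA gmulgV gmul1g. Qed.

Lemma ginv_eq x y : gmul x y = gone -> ginv x = y.
Proof. by move=> xy1; apply: (@gmulI x); rewrite gmulgV xy1. Qed.

Lemma ginvK x : ginv (ginv x) = x.
Proof. by apply: ginv_eq; rewrite gmulVg. Qed.

Lemma gmulVK x y : gmul (ginv x) (gmul x y) = y.
Proof. by rewrite gmulA gmulVg gmul1g. Qed.

Lemma gmulKV x y : gmul x (gmul (ginv x) y) = y.
Proof. by rewrite gmulA gmulgV gmul1g. Qed.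

Lemma ginvM x y : ginv (gmul x y) = gmul (ginv y) (ginv x).
Proof. by apply: ginv_eq; rewrite -gmulA gmulKV gmulgV. Qed.

End GrpTheory.

Section HomTheory.
Variables (G H : Grp) (f : G -> H).
Hypothesis fM : is_hom f.

Lemma hom1 : f gone = gone.
Proof. by apply: (@gmulI _ (f gone)); rewrite -fM gmul1g gmulg1. Qed.

Lemma homV x : f (ginv x) = ginv (f x).
Proof. by apply/esym/ginv_eq; rewrite -fM gmulgV hom1. Qed.

Lemma hom_pow x n : f (gpow x n) = gpow (f x) n.
Proof. by elim: n => [|n IHn] /=; rewrite ?hom1 // fM IHn. Qed.

End HomTheory.

Definition grp_of (gT : finGroupType) : Grp :=
  @MkGrp gT (@mulg gT) 1%g (@invg gT) (@mulgA gT) (@mul1g gT) (@mulVg gT).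

Lemma gpow_expg (gT : finGroupType) (x : grp_of gT) n :
  gpow x n = ((x : gT) ^+ n)%g.
Proof. by elim: n => [|n IHn] //=; rewrite IHn expgS. Qed.

Section Completion.
Variables (G : Grp) (gT : finGroupType).

Section Ker.
Variable f : G -> grp_of gT.
Hypothesis fM : is_hom f.

Lemma normal_ker : normal_subgroup (fun x => f x = gone).
Proof.
split; first exact: hom1.
split=> [x y fx fy|g x fx]; first by rewrite fM (homV fM) fx fy gmulgV.
by rewrite fM fM fx gmul1g -fM gmulVg hom1.
Qed.

Lemma finite_index_ker : finite_index (fun x => f x = gone).
Proof.
have pick (y : gT) : exists x, (exists x', f x' = y) -> f x = y.
  case: (classic (exists x', f x' = y)) => [[x' <-]|no]; first by exists x'.
  by exists gone.
pose r y := proj1_sig (constructive_indefinite_description _ (pick y)).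
have fr x : f (r (f x)) = f x.
  by rewrite /r; case: constructive_indefinite_description => /= z; apply; exists x.
exists (List.map r (enum gT)) => x; exists (r (f x)); split.
  apply: in_map; have: f x \in enum gT by rewrite mem_enum.
  by elim: (enum gT) => //= a l IHl; rewrite inE => /orP[/eqP->|/IHl]; [left|right].
by rewrite fM (homV fM) fr gmulVg.
Qed.

Definition ker_FNS : FNS G :=
  exist _ (fun x => f x = gone) (conj normal_ker finite_index_ker).

(* The extension of [f] to the completion. *)
Definition hat (x : compl G) : gT := f (cf x ker_FNS).

Lemma hat_agree x y : cagree ker_FNS x y -> hat x = hat y.
Proof.
rewrite /cagree /= fM (homV fM) => /(congr1 (gmul (hat x : grp_of gT))).
by rewrite gmulKV gmulg1.
Qed.

Lemma hat_ceq x y : ceq x y -> hat x = hat y.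
Proof. by move/(_ ker_FNS)/hat_agree. Qed.

Lemma hatM x y z : cprod x y z -> hat z = (hat x * hat y)%g.
Proof.
move/(_ ker_FNS); rewrite /= fM (homV fM) => /(congr1 (gmul (hat z : grp_of gT))).
by rewrite gmulKV gmulg1 fM.
Qed.

Lemma hat_cf (N : FNS G) x :
  (forall y, proj1_sig N y -> f y = gone) -> hat x = f (cf x N).
Proof.
move=> sNK; have := @ccompat _ x N ker_FNS sNK.
rewrite /= fM (homV fM) => /(congr1 (gmul (hat x : grp_of gT))).
by rewrite gmulKV gmulg1.
Qed.

End Ker.

Lemma compl_const_subproof (x : G) (N M : FNS G) :
  (forall y, proj1_sig N y -> proj1_sig M y) -> proj1_sig M (gmul (ginv x) x).
Proof. by rewrite gmulVg; case: M => M [[]]. Qed.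

End Completion.

Definition compl_const (G : Grp) (x : G) : compl G :=
  MkCompl (@compl_const_subproof G x).

Lemma compl_constM (G : Grp) (x y : G) : cprod (compl_const x) (compl_const y) (compl_const (gmul x y)).
Proof. by move=> [N [[N1 _] ?]] /=; rewrite gmulVg. Qed.

Section Generation.
Variables (V : finType) (adj : rel V) (m : V -> V -> nat) (G : Grp) (s : V -> G).
Hypothesis Ps : coxeter_presentation adj m s.

Lemma hom_gen_eq (H : Grp) (f f' : G -> H) :
  is_hom f -> is_hom f' -> (forall v, f (s v) = f' (s v)) -> forall x, f x = f' x.
Proof.
move=> fM f'M ff' x; have [_ [/(_ x)[l ->] _]] := Ps.
by elim: l => [|v l IHl] /=; rewrite ?hom1 // fM f'M ff' IHl.
Qed.

End Generation.

Lemma relations_hom (V : finType) (adj : rel V) (m : V -> V -> nat) (G H : Grp)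
    (s : V -> G) (f : G -> H) :
  is_hom f -> coxeter_relations adj m s -> coxeter_relations adj m (f \o s).
Proof.
move=> fM [s2 sm]; split=> [v|v w vw] /=; rewrite -fM ?s2 ?hom1 //.
by rewrite -(hom_pow fM) sm // hom1.
Qed.

Definition fin_rel (V : finType) (adj : rel V) (m : V -> V -> nat)
    (gT : finGroupType) (t : V -> gT) := coxeter_relations (H := grp_of gT) adj m t.

(* [C] is a natural bijection between the homomorphisms of two Coxeter groups to
   finite groups, both recorded as tuples of images of the generators. *)
Record transfer (V V' : finType) (adj : rel V) (m : V -> V -> nat)
    (adj' : rel V') (m' : V' -> V' -> nat)
    (C : forall gT : finGroupType, (V -> gT) -> (V' -> gT) -> Prop) : Prop := Transfer {
  transfer_rel : forall (gT : finGroupType) (t : V -> gT) t',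
    C gT t t' -> fin_rel adj m t /\ fin_rel adj' m' t';
  transfer_l : forall (gT : finGroupType) (t : V -> gT),
    fin_rel adj m t -> exists t', C gT t t';
  transfer_r : forall (gT : finGroupType) (t' : V' -> gT),
    fin_rel adj' m' t' -> exists t, C gT t t';
  transfer_fun : forall (gT : finGroupType) (t u : V -> gT) t' u',
    C gT t t' -> C gT u u' -> t =1 u -> t' =1 u';
  transfer_inj : forall (gT : finGroupType) (t u : V -> gT) t' u',
    C gT t t' -> C gT u u' -> t' =1 u' -> t =1 u;
  transfer_nat : forall (gT hT : finGroupType) (f : gT -> hT) (t : V -> gT) t',
    {morph f : x y / (x * y)%g} -> C gT t t' -> C hT (f \o t) (f \o t')
}.

Section OneSide.
Variables G G' : Grp.
Variables (F : compl G -> compl G').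
Hypothesis hF : chom F.
Variables (gT : finGroupType) (f' : G' -> grp_of gT).
Hypothesis f'M : is_hom f'.

(** A homomorphism from [G'] to a finite group is carried to [G] by extending it to the completion,
    composing with [F] and restricting to [G]. *)
Definition pull (x : G) : grp_of gT := hat f'M (F (compl_const x)).

Lemma pullM : is_hom pull.
Proof. by move=> x y; rewrite /pull (hatM f'M (hF.2.1 _ _ _ (compl_constM x y))). Qed.

(** Both sides are continuous and agree on the image of [G]: continuity of [F] yields a level [N] at
    which [x] may be replaced by the constant family of its coordinate [cf x N]. *)
Lemma hat_pull x : hat pullM x = hat f'M (F x).
Proof.
have [N sN] := hF.2.2 (ker_FNS f'M).
rewrite (@hat_cf _ _ _ pullM N).
  by apply/esym/hat_agree/sN; rewrite /cagree /= gmulVg; case: (N) => ? [[]].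
move=> y Ny; rewrite -(hom1 pullM); apply/esym/hat_agree/sN.
have g1 : ginv gone = gone :> G by apply: ginv_eq; rewrite gmul1g.
by rewrite /cagree /= g1 gmul1g.
Qed.

End OneSide.

Section TransferThm.
Variables (V V' : finType) (adj : rel V) (m : V -> V -> nat).
Variables (adj' : rel V') (m' : V' -> V' -> nat) (G G' : Grp) (s : V -> G) (s' : V' -> G').
Hypotheses (Ps : coxeter_presentation adj m s) (Ps' : coxeter_presentation adj' m' s').

Definition matched (F : compl G -> compl G') (gT : finGroupType)
    (t : V -> gT) (t' : V' -> gT) : Prop :=
  exists (f : G -> grp_of gT) (f' : G' -> grp_of gT) (fM : is_hom f) (f'M : is_hom f'),
  [/\ forall v, f (s v) = t v, forall v, f' (s' v) = t' v &
      forall x, hat fM x = hat f'M (F x)].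

Lemma hat_compl_const (H : Grp) (gT : finGroupType) (f : H -> grp_of gT) (fM : is_hom f) x :
  hat fM (compl_const x) = f x.
Proof. by []. Qed.

Lemma hat_comp (H : Grp) (gT hT : finGroupType) (f : H -> grp_of gT) (fM : is_hom f)
    (h : grp_of gT -> grp_of hT) (hM : is_hom h) (hfM : is_hom (h \o f)) x :
  hat hfM x = h (hat fM x).
Proof. by apply: hat_cf => y /= ->; rewrite hom1. Qed.

Lemma hat_ext (H : Grp) (gT : finGroupType) (f1 f2 : H -> grp_of gT)
    (f1M : is_hom f1) (f2M : is_hom f2) x : f1 =1 f2 -> hat f1M x = hat f2M x.
Proof. by move=> f12; rewrite (@hat_cf _ _ _ f1M (ker_FNS f2M)) // => y; rewrite f12. Qed.

(** Homomorphisms on [G] are pulled back along [K], those on [G'] along [F]. Uniqueness holds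
    because the values on generators determine a homomorphism and hence its extension. *)
Theorem transfer_compl_iso : compl_iso G G' ->
  exists C : forall gT : finGroupType, (V -> gT) -> (V' -> gT) -> Prop,
    transfer adj m adj' m' C.
Proof.
move=> [F [K [hF [hK [FK KF]]]]]; exists (matched F); split.
- move=> gT t t' [f [f' [fM [f'M [ft ft' _]]]]].
  have [E E'] : fin_rel adj m (f \o s) /\ fin_rel adj' m' (f' \o s').
    by split; apply: relations_hom => //; [case: Ps | case: Ps'].
  by case: E E' => r1 r2 [r1' r2']; split; split=> *;
    rewrite -?ft -?ft'; [exact: r1 | exact: r2 | exact: r1' | exact: r2'].
- move=> gT t Rt; have [f [fM ft]] := Ps.2.2 (grp_of gT) t Rt.
  have hE x : hat fM x = hat (pullM hK fM) (F x).
    by rewrite hat_pull; apply/esym/hat_ceq/FK.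
  exists (pull K fM \o s'), f, (pull K fM), fM, (pullM hK fM); split=> //.
- move=> gT t' Rt'; have [f' [f'M ft']] := Ps'.2.2 (grp_of gT) t' Rt'.
  exists (pull F f'M \o s), (pull F f'M), f', (pullM hF f'M), f'M; split=> // x.
  exact: hat_pull.
- move=> gT t u t' u' [f [f' [fM [f'M [ft ft1 ff']]]]] [h [h' [hM [h'M [ht ht1 hh']]]]] tu v.
  rewrite -ft1 -ht1 -(hat_compl_const f'M) -(hat_compl_const h'M).
  rewrite -(hat_ceq f'M (KF _)) -(hat_ceq h'M (KF _)) -ff' -hh'; apply: hat_ext.
  by apply: (hom_gen_eq Ps fM hM) => w; rewrite ft ht tu.
- move=> gT t u t' u' [f [f' [fM [f'M [ft ft1 ff']]]]] [h [h' [hM [h'M [ht ht1 hh']]]]] tu v.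
  rewrite -ft -ht -(hat_compl_const fM) -(hat_compl_const hM) ff' hh'; apply: hat_ext.
  by apply: (hom_gen_eq Ps' f'M h'M) => w; rewrite ft1 ht1 tu.
- move=> gT hT p t t' pM [f [f' [fM [f'M [ft ft' ff']]]]].
  have p_hom : is_hom (p : grp_of gT -> grp_of hT) by move=> x y; apply: pM.
  have pfM : is_hom ((p : grp_of gT -> grp_of hT) \o f) by move=> x y /=; rewrite fM pM.
  have pf'M : is_hom ((p : grp_of gT -> grp_of hT) \o f') by move=> x y /=; rewrite f'M pM.
  exists (p \o f), (p \o f'), pfM, pf'M; split=> [v|v|x] /=; rewrite ?ft ?ft' //.
  by rewrite (hat_comp fM) // (hat_comp f'M) // ff'.
Qed.

End TransferThm.

(** A lift [u] of [t] has a partner [u']; by naturality [p \o u'] is the partner of [p \o u], and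
    partners are unique, so [u'] lies over [t']. This is how the lifting property (1) passes to
    [W]. *)
Lemma transfer_lift (V V' : finType) (adj : rel V) m (adj' : rel V') m'
    (C : forall gT : finGroupType, (V -> gT) -> (V' -> gT) -> Prop)
    (E B : finGroupType) (p : E -> B) (t : V -> B) (t' : V' -> B) (u : V -> E) :
  transfer adj m adj' m' C -> {morph p : x y / (x * y)%g} -> C B t t' ->
  fin_rel adj m u -> (forall v, p (u v) = t v) ->
  exists2 u' : V' -> E, fin_rel adj' m' u' & forall v, p (u' v) = t' v.
Proof.
move=> tC pM Ct Ru pu; have [u' Cu] := transfer_l tC Ru.
exists u'; first by case: (transfer_rel tC Cu).
exact: transfer_fun tC _ _ _ _ _ (transfer_nat tC pM Cu) Ct pu.
Qed.

(** * Star-shaped graphs and lifting along extensions *)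

Lemma gpow_swap (G : Grp) (x y : G) n :
  gmul x x = gone -> gmul y y = gone ->
  gpow (gmul x y) n = gone -> gpow (gmul y x) n = gone.
Proof.
move=> x2 y2 xyn; have yx : gmul y x = gmul (ginv x) (gmul (gmul x y) x).
  by rewrite !gmulA gmulVg gmul1g.
have -> : gpow (gmul y x) n = gmul (ginv x) (gmul (gpow (gmul x y) n) x).
  elim: n {xyn} => [|n IHn] /=; first by rewrite gmul1g gmulVg.
  by rewrite IHn {1}yx -!gmulA gmulKV.
by rewrite xyn gmul1g gmulVg.
Qed.

Section Star.
Variables (V : finType) (rt : V -> V) (mm : V -> nat).

(** A disjoint union of stars is encoded by an idempotent map [rt]: its fixed points are the
    centres, and [mm v] is the label of the edge from [rt v] to the leaf [v]. *)
Definition star_adj : rel V := fun v w => (v != w) && ((rt v == w) || (rt w == v)).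
Definition star_label (v w : V) := if rt v == w then mm v else mm w.

Definition star_rel (H : Grp) (t : V -> H) : Prop :=
  (forall v, gmul (t v) (t v) = gone) /\
  (forall v, rt v != v -> gpow (gmul (t (rt v)) (t v)) (mm v) = gone).

Hypothesis rtK : forall v, rt (rt v) = rt v.

Lemma star_relP (H : Grp) (t : V -> H) :
  coxeter_relations star_adj star_label t <-> star_rel t.
Proof.
split=> [] [t2 tm]; split=> //; [move=> v rtv|move=> v w].
  have := tm (rt v) v; rewrite /star_adj /star_label rtv rtK eqxx orbT (negPf rtv).
  by apply.
case/andP; rewrite /star_label; case: (rt v =P w) => [<- nvw _|_ nvw /= /eqP e].
  by apply: (gpow_swap (t2 _) (t2 _)); apply: tm; rewrite eq_sym.
by rewrite -e; apply: tm; rewrite e.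
Qed.

End Star.

Lemma rot_conj (gT : finGroupType) (x y : gT) n : (x * x = 1 -> y * y = 1 ->
  x * (x * y) ^+ n * x = ((x * y) ^+ n)^-1)%g.
Proof.
move=> x2 y2; have xy_inv : ((x * y)^-1 = y * x)%g.
  by apply/eqP; rewrite eq_invg_mul mulgA -[(x * y * y)%g]mulgA y2 mulg1 x2.
rewrite -expgVn xy_inv; elim: n => [|n IHn]; first by rewrite mulg1.
by rewrite !expgS -IHn !mulgA x2 mul1g -[(y * x * x)%g]mulgA x2 mulg1.
Qed.

Section Lifting.
Local Open Scope group_scope.
Variables (E B : finGroupType) (p : E -> B).
Hypothesis pM : {morph p : x y / x * y}.

Lemma morph_one : p 1 = 1.
Proof. by apply: (mulgI (p 1)); rewrite -pM !mulg1. Qed.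

Lemma morph_exp x n : p (x ^+ n) = p x ^+ n.
Proof. by elim: n => [|n IHn]; rewrite ?morph_one // !expgS pM IHn. Qed.

Variable n : nat.
Hypothesis ker_exp : forall z, p z = 1 -> z ^+ n = 1.

(** [y] is replaced by [x * c], where [c] is a power of [x * y] with the same image but of order
    dividing [k]. Since [x] inverts [c], the product [x * c] is again an involution. *)
Lemma lift_dihedral (x y : E) (k : nat) : 0 < k -> coprime k n ->
  x * x = 1 -> y * y = 1 -> (p x * p y) ^+ k = 1 ->
  exists y', [/\ p y' = p y, y' * y' = 1 & (x * y') ^+ k = 1].
Proof.
move=> k0 co x2 y2 xyk.
(* Modulo the kernel, [N] acts on exponents as 1; on exponents of the kernel, as 0. *)
pose N := chinese k n 1 0.
have eN1 : N = 1 %[mod k] by rewrite /N chinese_modl.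
have eN0 : N = 0 %[mod n] by rewrite /N chinese_modr.
pose c := (x * y) ^+ N.
have conj_c : x * c * x = c^-1 by apply: rot_conj.
exists (x * c); split.
- rewrite pM morph_exp pM.
  have -> : (p x * p y) ^+ N = p x * p y.
    rewrite (divn_eq N k) eN1 expgD mulnC expgM xyk expg1n mul1g.
    by case: (k) xyk => [|[|j]].
  by rewrite mulgA -pM x2 morph_one mul1g.
- by rewrite mulgA conj_c mulVg.
- rewrite mulgA x2 mul1g -expgM mulnC expgM.
  have /dvdnP[j ->] : n %| N by rewrite /dvdn eN0 mod0n.
  by rewrite mulnC expgM ker_exp ?expg1n // morph_exp pM.
Qed.

Variables (V : finType) (rt : V -> V) (mm : V -> nat).
Hypothesis rtK : forall v, rt (rt v) = rt v.

(** Centres are lifted to arbitrary involutions. Each leaf is related only to its centre, so the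
    dihedral correction can be made leaf by leaf without conflict. *)
Lemma lift_star (f : V -> B) :
  (forall v, rt v != v -> 0 < mm v /\ coprime (mm v) n) ->
  star_rel rt mm (f : V -> grp_of B) ->
  (forall v, exists2 y, y * y = 1 & p y = f v) ->
  exists2 t : V -> E, star_rel rt mm (t : V -> grp_of E) & forall v, p (t v) = f v.
Proof.
move=> co [f2 fm] lf.
have /fin_all_exists[u u_P] v : exists y, y * y = 1 /\ p y = f v.
  by case: (lf v) => y; exists y.
have /fin_all_exists[t t_P] v : exists y, [/\ y * y = 1, p y = f v &
    if rt v == v then y = u v else (u (rt v) * y) ^+ mm v = 1].
  have [u2 pu] := u_P v; case: eqVneq => [_|rtv]; first by exists (u v).
  have [m0 mco] := co v rtv; have [u2' pu'] := u_P (rt v).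
  have [|y [py y2 ym]] := lift_dihedral m0 mco u2' u2.
    by rewrite pu pu'; have := fm v rtv; rewrite gpow_expg.
  by exists y; split; rewrite // -pu.
exists t => [|v]; last by case: (t_P v).
split=> v; first by case: (t_P v).
move=> rtv; rewrite gpow_expg /=; have [_ _] := t_P v; rewrite (negPf rtv).
by have [_ _] := t_P (rt v); rewrite rtK eqxx => ->.
Qed.

End Lifting.

Local Open Scope group_scope.

(** * Wreath products and induction *)

Definition wreath (E : finGroupType) (X : finType) := ({ffun X -> E} * {perm X})%type.
HB.instance Definition _ (E : finGroupType) (X : finType) := Finite.on (wreath E X).

Section Wreath.
Variables (E : finGroupType) (X : finType).
Implicit Types a b c : wreath E X.

(** The element [(a, s)] acts on [E] times [X] from the left by (e, x) -> (a x * e, s x); since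
    products of permutations apply the left factor first, the permutations are multiplied in reverse
    order. *)
Definition wreath_mul a b : wreath E X :=
  ([ffun x => a.1 (b.2 x) * b.1 x], b.2 * a.2).
Definition wreath_one : wreath E X := ([ffun=> 1], 1).
Definition wreath_inv a : wreath E X := ([ffun x => (a.1 (a.2^-1 x))^-1], a.2^-1).

Lemma wreath_mulA : associative wreath_mul.
Proof.
move=> a b c; congr pair; last by rewrite /= mulgA.
by apply/ffunP=> x; rewrite !ffunE /= permM mulgA.
Qed.

Lemma wreath_mul1 : left_id wreath_one wreath_mul.
Proof.
case=> a s; congr pair; last by rewrite /= mulg1.
by apply/ffunP=> x; rewrite !ffunE mul1g.
Qed.

Lemma wreath_mulV : left_inverse wreath_one wreath_inv wreath_mul.
Proof.
case=> a s; congr pair; last by rewrite /= mulgV.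
by apply/ffunP=> x; rewrite !ffunE /= permK mulVg.
Qed.

HB.instance Definition _ := Finite_isGroup.Build (wreath E X)
  wreath_mulA wreath_mul1 wreath_mulV.

Lemma wreath1_fix a b x : b.2 x = x -> (a * b).1 x = a.1 x * b.1 x.
Proof. by move=> bx; rewrite ffunE bx. Qed.

Lemma wreath2_fix a b x : a.2 x = x -> b.2 x = x -> (a * b).2 x = x.
Proof. by move=> ax bx; rewrite permM bx ax. Qed.

Lemma wreathX_fix a x n : a.2 x = x -> (a ^+ n).2 x = x /\ (a ^+ n).1 x = a.1 x ^+ n.
Proof.
move=> ax; elim: n => [|n [IH2 IH1]]; first by rewrite perm1 ffunE.
by rewrite !expgS; split; [apply: wreath2_fix | rewrite wreath1_fix ?IH1].
Qed.

End Wreath.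

Section WreathMap.
Variables (E B : finGroupType) (X : finType) (p : E -> B).
Hypothesis pM : {morph p : x y / x * y}.

Definition wreath_map (a : wreath E X) : wreath B X := ([ffun x => p (a.1 x)], a.2).

Lemma wreath_mapM : {morph wreath_map : a b / a * b}.
Proof. by move=> a b; congr pair; apply/ffunP=> x; rewrite !ffunE pM. Qed.

Lemma wreath_map_ker n : (forall z, p z = 1 -> z ^+ n = 1) ->
  forall a, wreath_map a = 1 -> a ^+ n = 1.
Proof.
move=> kp a a1; have e2 : a.2 = 1 by exact: (congr1 (fun b : wreath B X => b.2) a1).
have e1 x : p (a.1 x) = 1.
  by have := congr1 (fun b : wreath B X => b.1 x) a1; rewrite !ffunE.
have fx x : a.2 x = x by rewrite e2 perm1.
rewrite [a ^+ n]surjective_pairing; congr pair.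
  by apply/ffunP=> x; rewrite (wreathX_fix n (fx x)).2 kp ?e1 ?ffunE.
by apply/permP=> x; rewrite (wreathX_fix n (fx x)).1 perm1.
Qed.

End WreathMap.

(* The Krasner-Kaloujnine embedding: a morphism defined on a subgroup [H] of [Q]
   extends to a morphism from [Q] to a wreath product over the cosets of [H];
   the coset [H] itself is a fixed point of [H] at which one recovers [h]. *)
Section Coinduction.
Variables (Q B : finGroupType) (H : {group Q}) (h : Q -> B).
Hypothesis hM : {in H &, {morph h : x y / x * y}}.

Lemma lcoset_perm_subproof (q : Q) : injective (fun A : {set Q} => q *: A).
Proof. by move=> A A' /(congr1 (fun A => q^-1 *: A)); rewrite !lcosetK. Qed.
Definition lcoset_perm q : {perm {set Q}} := perm (@lcoset_perm_subproof q).

(** The argument of [h] compares the translate by [q] of the representative of [A] with the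
    representative of the coset [q *: A]. Sets that are not cosets get the default value 1. *)
Definition coind_cocycle (q : Q) (A : {set Q}) : B :=
  if A \in lcosets H [set: Q] then h ((repr (q *: A))^-1 * q * repr A) else 1.

Definition coind (q : Q) : wreath B {set Q} :=
  ([ffun A => coind_cocycle q A], lcoset_perm q).

Lemma lcosets_lcoset q A : (q *: A \in lcosets H [set: Q]) = (A \in lcosets H [set: Q]).
Proof.
apply/lcosetsP/lcosetsP => -[x _ e]; last by exists (q * x); rewrite ?inE // lcosetM -e.
by exists (q^-1 * x); rewrite ?inE // lcosetM -e lcosetK.
Qed.

Lemma repr_lcosets q A : A \in lcosets H [set: Q] -> (repr (q *: A))^-1 * q * repr A \in H.
Proof.
case/lcosetsP=> x _ ->; rewrite -lcosetM.
have rP y : repr (y *: H) \in y *: H by apply: (mem_repr y); apply: lcoset_refl.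
case/lcosetP: (rP x) (rP (q * x)) => a aH -> /lcosetP[b bH ->].
by rewrite !invMg !mulgA mulgKV mulgKV groupM ?groupV.
Qed.

Lemma coindM : {morph coind : q r / q * r}.
Proof.
move=> q r; congr pair; last by apply/permP=> A; rewrite permM !permE lcosetM.
apply/ffunP=> A; rewrite !ffunE permE /coind_cocycle lcosets_lcoset; case: ifP => [cA|_].
  rewrite -hM ?repr_lcosets ?lcosets_lcoset // -lcosetM; congr h.
  by rewrite !mulgA mulgK.
by rewrite mulg1.
Qed.

Lemma coind_fix q : q \in H -> (coind q).2 (H : {set Q}) = H.
Proof. by move=> qH; rewrite permE lcoset_id. Qed.

Lemma coind_val q : q \in H -> (coind q).1 (H : {set Q}) = h q.
Proof.
move=> qH; rewrite ffunE /coind_cocycle lcoset_id // repr_group invg1 mul1g mulg1.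
by case: lcosetsP => // -[]; exists 1; rewrite ?inE // lcoset1.
Qed.

End Coinduction.

(* The two sheets over a 2-cycle of [b] can be lifted independently. *)
Lemma wreath_lift_involution (E B : finGroupType) (X : finType) (p : E -> B) (l : B -> E)
    (b : wreath B X) :
  {morph p : x y / x * y} -> cancel l p -> b * b = 1 ->
  (forall x, b.2 x = x -> b.1 x = 1) ->
  exists2 a : wreath E X, a * a = 1 & wreath_map p a = b.
Proof.
move=> pM lK bb bfix.
have b2 x : b.2 (b.2 x) = x.
  by have := congr1 (fun c : wreath B X => c.2 x) bb; rewrite permM perm1.
have b1 x : b.1 (b.2 x) * b.1 x = 1.
  by have := congr1 (fun c : wreath B X => c.1 x) bb; rewrite !ffunE.
have p1 : p 1 = 1 by apply: morph_one.
have pV x : p x^-1 = (p x)^-1 by apply: (mulgI (p x)); rewrite -pM !mulgV.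
pose a1 := [ffun x => if x == b.2 x then 1 else
  if (enum_rank x < enum_rank (b.2 x))%N then l (b.1 x) else (l (b.1 (b.2 x)))^-1].
exists ((a1, b.2) : wreath E X).
  rewrite [LHS]surjective_pairing; congr pair; last by apply/permP=> x; rewrite permM b2 perm1.
  apply/ffunP=> x; rewrite !ffunE /= b2 [b.2 x == x]eq_sym.
  have [_|nbx] := eqVneq; first by rewrite mulg1.
  case: ltngtP => [_|_|/ord_inj/enum_rank_inj e]; rewrite ?mulgV ?mulVg //.
  by rewrite e eqxx in nbx.
rewrite [RHS]surjective_pairing; congr pair; apply/ffunP=> x; rewrite !ffunE.
have [/esym bx|_] := eqVneq; first by rewrite p1 bfix.
case: ifP => _; rewrite ?pV lK //; apply: (mulgI (b.1 (b.2 x))).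
by rewrite b1 mulgV.
Qed.

Local Close Scope group_scope.
Local Open Scope ring_scope.

(** * Finite fields *)

Lemma finfield_prim_root (F : finFieldType) (n : nat) : (n > 0)%N -> (n %| #|F|.-1)%N ->
  exists z : F, n.-primitive_root z.
Proof.
move=> n0 nF; have F1 : (0 < #|F|.-1)%N.
  by have := finNzRing_gt1 F; case: #|F| => [|[]].
pose rs := [seq x <- enum F | x != 0].
have /hasP[z _ zP] : has #|F|.-1.-primitive_root rs.
  apply: has_prim_root => //.
  - apply/allP=> x; rewrite mem_filter mem_enum andbT => x0; rewrite unity_rootE.
    apply/eqP/(mulfI x0); rewrite -exprS prednK ?mulr1 ?expf_card //.
    by rewrite ltnW // finNzRing_gt1.
  - by rewrite filter_uniq ?enum_uniq.
  - rewrite size_filter; have -> : count (fun x : F => x != 0) (enum F) = #|predC1 (0 : F)|.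
      by rewrite -size_filter cardE enumT.
    by rewrite cardC1.
by exists (z ^+ (#|F|.-1 %/ n)); apply: dvdn_prim_root.
Qed.

(** By Euler's theorem [n] divides p ^ (totient n * j) - 1. The free exponent [j] supplies fields of
    infinitely many sizes for the counting argument. *)
Lemma finfield_of_order (p n j : nat) : prime p -> (0 < n)%N -> coprime n p -> (0 < j)%N ->
  exists F : finFieldType, [/\ p \in [pchar F], #|F| = (p ^ (totient n * j))%N &
    exists z : F, n.-primitive_root z].
Proof.
move=> pp n0 np j0; have k0 : (0 < totient n * j)%N by rewrite muln_gt0 totient_gt0 n0.
have [F pF cF] := pPrimePowerField pp k0.
exists F; split=> //; apply: finfield_prim_root => //; rewrite cF -subn1 -eqn_mod_dvd.
  rewrite expnM -modnXm Euler_exp_totient 1?coprime_sym // modnXm.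
  by rewrite exp1n.
by rewrite expn_gt0 prime_gt0.
Qed.

Lemma frobenius_iter (F : finFieldType) p k : p \in [pchar F] ->
  exists f : {rmorphism F -> F}, forall x, f x = x ^+ (p ^ k).
Proof.
move=> pF; elim: k => [|k [f fE]]; first by exists idfun => x; rewrite expn0 expr1.
exists (pFrobenius_aut pF \o f : {rmorphism F -> F}) => x /=.
by rewrite fE pFrobenius_autE -exprM -expnSr.
Qed.

(** [F] is quadratic over the field with Q = p ^ totient n elements, and [f] is x -> x ^ Q. The
    fixed field contains the [n]-th roots of unity; its nonzero elements are powers of a generator
    [g] with exponents divisible by Q + 1, which is even. *)
Lemma finfield_with_sqrt (p n : nat) : prime p -> odd p -> (0 < n)%N -> coprime n p ->
  exists F : finFieldType, [/\ p \in [pchar F], exists z : F, n.-primitive_root z &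
    exists f : {rmorphism F -> F}, (forall x, x ^+ n = 1 -> f x = x) /\
      forall x, f x = x -> exists y, y * y = x].
Proof.
move=> pp op n0 np; have [F [pF cF [z zP]]] := finfield_of_order pp n0 np (isT : 0 < 2)%N.
exists F; split=> //; first by exists z.
pose Q := (p ^ totient n)%N; have [f fE] := frobenius_iter (totient n) pF.
exists f; split=> x.
  move=> xn; rewrite fE -/Q.
  have Q1 : (Q = 1 %[mod n])%N by rewrite Euler_exp_totient // coprime_sym.
  rewrite (divn_eq Q n) Q1 exprD mulnC exprM xn expr1n mul1r.
  by case: (n) xn => [|[|k]] //=; rewrite ?modn1 ?expr1 // modn_small.
rewrite fE -/Q => xQ; have [->|x0] := eqVneq x 0; first by exists 0; rewrite mulr0.
have oQ : odd Q by rewrite oddX op orbT.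
have Q0 : (0 < Q)%N by rewrite expn_gt0 prime_gt0.
have F1 : (0 < #|F|.-1)%N by have := finNzRing_gt1 F; case: #|F| => [|[]].
have [g gP] := finfield_prim_root F1 (dvdnn _).
have xF : x ^+ #|F|.-1 = 1.
  by apply: (mulfI x0); rewrite -exprS prednK ?mulr1 ?expf_card // ltnW // finNzRing_gt1.
have [[i _] /= xi] := prim_rootP gP xF.
have xQ1 : x ^+ Q.-1 = 1 by apply: (mulfI x0); rewrite -exprS prednK ?mulr1.
have cQ : (#|F|.-1 = Q.-1 * Q.+1)%N.
  by rewrite cF expnM -/Q; case: (Q) Q0 => // k _; rewrite -[k.+1.-1]/k; nia.
move: xQ1; rewrite xi -exprM => /eqP; rewrite -(prim_order_dvd gP) cQ mulnC.
rewrite dvdn_pmul2r; last by move: F1; rewrite cQ; case: (Q.-1).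
move=> Qi; have i2 : (2 %| i)%N.
  by apply: dvdn_trans Qi; rewrite dvdn2 /= oQ.
by exists (g ^+ (i %/ 2)); rewrite -exprD addnn -muln2 divnK.
Qed.

(** * Finite reflection representations *)

(** The recurrence has characteristic roots [z] and [z^-1], distinct because [z * z] is not 1. Both
    have [n]-th power [c], as [c] is its own inverse. *)
Lemma linrec_pow (F : fieldType) (z c : F) (n : nat) (y : nat -> F) :
  z != 0 -> z * z != 1 -> z ^+ n = c -> c * c = 1 ->
  (forall j, y j.+2 = (z + z^-1) * y j.+1 - y j) -> y n = c * y 0.
Proof.
move=> z0 z1 zn cc yE; have z' : z - z^-1 != 0.
  apply: contra z1 => /eqP/(congr1 ( *%R z)); rewrite mulrBr mulfV // mulr0 => /eqP.
  by rewrite subr_eq0.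
have c0 : c != 0 by apply: contra_eq_neq cc => ->; rewrite mul0r eq_sym oner_neq0.
have zVn : z^-1 ^+ n = c by rewrite exprVn zn; apply: (mulfI c0); rewrite mulfV.
have u j : y j.+1 - z^-1 * y j = z ^+ j * (y 1 - z^-1 * y 0).
  elim: j => [|j IHj]; first by rewrite expr0 mul1r.
  by rewrite exprS -mulrA -IHj yE; field.
have w j : y j.+1 - z * y j = z^-1 ^+ j * (y 1 - z * y 0).
  elim: j => [|j IHj]; first by rewrite expr0 mul1r.
  by rewrite exprS -mulrA -IHj yE; field.
apply: (mulfI z'); transitivity ((y n.+1 - z^-1 * y n) - (y n.+1 - z * y n)); first by ring.
by rewrite u w zn zVn; ring.
Qed.

Section Reflections.
Variables (F : finFieldType) (V : finType) (A : V -> V -> F).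
Hypothesis A2 : forall v, A v v = 2%:R.
Local Notation T := {ffun V -> F}.

(** The contragredient of the geometric representation with Cartan matrix [A]: the mirror of [v] is
    the hyperplane [x v = 0], and the vector sent to its negative is column [v] of [A]. *)
Definition refl_fun (v : V) (x : T) : T := [ffun u => x u - x v * A u v].

Lemma refl_funK v : involutive (refl_fun v).
Proof. by move=> x; apply/ffunP=> u; rewrite !ffunE A2; ring. Qed.

Definition refl (v : V) : {perm T} := perm (inv_inj (@refl_funK v)).

Lemma reflE v (x : T) u : refl v x u = x u - x v * A u v.
Proof. by rewrite permE ffunE. Qed.

Lemma refl2 v : (refl v * refl v = 1)%g.
Proof. by apply/permP=> x; rewrite permM !permE refl_funK. Qed.

Hypothesis F2 : 2%:R != 0 :> F.

Variables (v w : V) (z : F).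
Hypotheses (z0 : z != 0) (z1 : z != 1) (Az : A v w * A w v = 2%:R + z + z^-1).
Hypothesis zN1 : z = -1 -> A v w = 0 /\ A w v = 0.

Lemma rot_det : 4%:R - A v w * A w v != 0.
Proof.
have -> : 4%:R - A v w * A w v = - (z - 1) ^+ 2 / z by rewrite Az; field.
by rewrite !mulf_neq0 ?invr_eq0 // oppr_eq0 expf_neq0 // subr_eq0.
Qed.

Definition rot_a (x : T) := (A v w * x w - 2%:R * x v) / (4%:R - A v w * A w v).
Definition rot_b (x : T) := (A w v * x v - 2%:R * x w) / (4%:R - A v w * A w v).

Fixpoint rot_seq (x : T) n : F * F :=
  if n is k.+1 then
    let: (a, b) := rot_seq x k in let a' := - a - x v - A v w * b in
    (a', - b - x w - A w v * a')
  else (0, 0).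

Lemma rot_pow_seq x n u : ((refl v * refl w) ^+ n)%g x u =
  x u + (rot_seq x n).1 * A u v + (rot_seq x n).2 * A u w.
Proof.
elim: n u => [|n IHn] u; first by rewrite perm1 /=; ring.
rewrite expgSr !permM !reflE !IHn /=; case: (rot_seq x n) => a b /=.
by rewrite !A2; ring.
Qed.

(** The deviation from [(rot_a x, rot_b x)], the fixed point of the recursion, satisfies the
    recurrence with roots [z] and [z^-1]. If these coincide then [z = -1], both off-diagonal entries
    vanish and the two reflections commute. *)
Lemma rot_seq_pow x n c : z ^+ n = c -> c * c = 1 ->
  (rot_seq x n).1 = (1 - c) * rot_a x /\ (rot_seq x n).2 = (1 - c) * rot_b x.
Proof.
move=> zn cc; have d0 := rot_det.
suff [E1 E2] : (rot_seq x n).1 - rot_a x = c * ((rot_seq x 0).1 - rot_a x) /\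
               (rot_seq x n).2 - rot_b x = c * ((rot_seq x 0).2 - rot_b x).
  move: E1 E2; rewrite /= !sub0r => E1 E2.
  by rewrite -[LHS](subrK (rot_a x)) -[X in _ /\ X = _](subrK (rot_b x)) E1 E2; split; ring.
case: (eqVneq (z * z) 1) => [zz|zz].
  have zE : z = -1.
    apply/eqP; rewrite -subr_eq0 opprK; have /eqP : (z - 1) * (z + 1) = 0.
      by transitivity (z * z - 1); [ring | rewrite zz subrr].
    by rewrite mulf_eq0 subr_eq0 (negPf z1).
  have [p0 q0] := zN1 zE; rewrite -{cc}zn zE /rot_a /rot_b p0 q0.
  have F4 : 4%:R != 0 :> F by move: d0; rewrite p0 mul0r subr0.
  elim: n => [|n [IH1 IH2]]; first by rewrite expr0; split; ring.
  rewrite exprS /=; move: IH1 IH2; case: (rot_seq x n) => a b /= IH1 IH2.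
  rewrite p0 q0; split; rewrite -mulrA -?IH1 -?IH2; field; exact: F4.
have s2 : A v w * A w v = 2%:R + (z + z^-1) by rewrite Az addrA.
split; apply: (linrec_pow (y := fun n => _ - _) z0 zz zn cc) => j /=;
  case: (rot_seq x j) => a b /=; rewrite -[z + z^-1](addKr 2%:R) -s2 /rot_a /rot_b;
  field; exact: d0.
Qed.

Lemma rot_pow x n c u : z ^+ n = c -> c * c = 1 ->
  ((refl v * refl w) ^+ n)%g x u = x u + (1 - c) * (rot_a x * A u v + rot_b x * A u w).
Proof. by move=> zn cc; rewrite rot_pow_seq; have [-> ->] := rot_seq_pow x zn cc; ring. Qed.

Lemma rot_pow1 n : z ^+ n = 1 -> ((refl v * refl w) ^+ n = 1)%g.
Proof.
move=> zn; apply/permP=> x; apply/ffunP=> u.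
by rewrite (rot_pow _ _ zn) ?mulr1 // perm1 subrr mul0r addr0.
Qed.

Definition root_vec (w : V) : T := [ffun u => A u w].

Lemma natr4_neq0 : 4%:R != 0 :> F.
Proof. by rewrite (natrM F 2 2) mulf_neq0. Qed.

Lemma refl_neq1 : refl v != 1%g.
Proof.
apply/eqP=> /permP/(_ (root_vec v))/ffunP/(_ v); rewrite reflE perm1 !ffunE A2.
move/eqP; rewrite -subr_eq0; apply/negP.
by have -> : 2 - 2 * 2 - 2 = - 4%:R :> F by [ring]; rewrite oppr_eq0 natr4_neq0.
Qed.

Lemma rot_half n u : z ^+ n = -1 -> ((refl v * refl w) ^+ n)%g (root_vec w) u = - A u w.
Proof.
move=> zn; rewrite (rot_pow _ _ zn) ?mulrNN ?mulr1 // /rot_a /rot_b !ffunE A2.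
by field; exact: rot_det.
Qed.

Lemma rot_half_neq1 n : z ^+ n = -1 -> ((refl v * refl w) ^+ n)%g != 1%g.
Proof.
move=> zn; apply/eqP=> /permP/(_ (root_vec w))/ffunP/(_ w); rewrite rot_half // perm1 ffunE A2.
move/eqP; rewrite -subr_eq0; apply/negP.
by have -> : - 2 - 2 = - 4%:R :> F by [ring]; rewrite oppr_eq0 natr4_neq0.
Qed.

Lemma refl_rot_half_neq1 n : z ^+ n = -1 -> (refl v * (refl v * refl w) ^+ n)%g != 1%g.
Proof.
move=> zn; apply/eqP => e; have {}e : ((refl v * refl w) ^+ n = refl v)%g.
  by apply: (mulgI (refl v)); rewrite e refl2.
have := rot_half w zn; rewrite e reflE !ffunE A2 => /eqP; rewrite -subr_eq0; apply/negP.
have -> : 2 - A v w * A w v - - 2 = 4%:R - A v w * A w v by ring.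
exact: rot_det.
Qed.

End Reflections.

(** Here 2 + z + z^-1 replaces 4 cos^2 (pi / m). Neither symmetry nor a value at non-adjacent pairs
    is prescribed, which leaves room for the special entries used along a cycle. *)
Definition cartan (V : finType) (adj : rel V) (m : V -> V -> nat) (F : finFieldType)
    (A : V -> V -> F) : Prop :=
  (forall v, A v v = 2%:R) /\
  forall v w, adj v w -> exists z, [/\ z ^+ m v w = 1, z != 1,
    A v w * A w v = 2%:R + z + z^-1 & z = -1 -> A v w = 0 /\ A w v = 0].

Lemma refl_fin_rel (V : finType) (adj : rel V) m (F : finFieldType) (A : V -> V -> F)
    (A2 : forall v, A v v = 2%:R) : coxeter_graph adj m ->
  cartan adj m A -> fin_rel adj m (refl A2).
Proof.
move=> [_ [_ [_ m2]]] [_ cA]; split=> [v|v w vw]; first exact: refl2.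
have [z [zm z1 Az zN]] := cA v w vw; rewrite gpow_expg /=.
have z0 : z != 0.
  apply/eqP=> z0; move: zm (m2 v w vw); rewrite z0.
  by case: (m v w) => // k; rewrite expr0n /= => /esym/eqP; rewrite oner_eq0.
exact: (rot_pow1 A2 z0 z1 Az zN zm).
Qed.

Section StandardCartan.
Variables (V : finType) (adj : rel V) (m : V -> V -> nat).
Hypothesis gr : coxeter_graph adj m.

Definition label_prod := (\prod_(e : V * V | adj e.1 e.2) m e.1 e.2)%N.

Lemma label_prod_gt0 : (0 < label_prod)%N.
Proof.
rewrite /label_prod; apply: prodn_cond_gt0 => -[v w] /= vw.
by apply: ltnW; case: gr => _ [_ [_]]; apply.
Qed.

Lemma coxeter_adj_neq v w : adj v w -> (v == w) = false.
Proof. by case: gr => _ [irr _]; apply: contraTF => /eqP->. Qed.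

Lemma dvdn_label v w : adj v w -> (m v w %| label_prod)%N.
Proof.
by move=> vw; rewrite /label_prod (bigD1 (v, w)) //= dvdn_mulr.
Qed.

Variables (F : finFieldType) (z : F).
Hypothesis zP : (2 * label_prod).-primitive_root z.

(** For adjacent [v] and [w] this power of [z] has order 2 * [m v w] and stands for exp (i pi / m),
    so that [std_entry] is the analogue of 2 cos (pi / m). *)
Definition half_angle v w := z ^+ (label_prod %/ m v w).
Definition std_entry v w : F :=
  if v == w then 2%:R else if adj v w then half_angle v w + (half_angle v w)^-1 else 0.

Lemma std_root_neq0 : z != 0.
Proof. by rewrite (prim_root_eq0 zP) muln_eq0 negb_or /= -lt0n label_prod_gt0. Qed.

Lemma std_root_label : z ^+ label_prod = -1.
Proof.
have zz : z ^+ label_prod * z ^+ label_prod = 1.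
  by rewrite -exprD addnn -mul2n (prim_expr_order zP).
have z1 : z ^+ label_prod != 1.
  rewrite -(prim_order_dvd zP); apply/negP => /dvdn_leq.
  by rewrite label_prod_gt0 => /(_ isT); have := label_prod_gt0; lia.
apply/eqP; rewrite -subr_eq0 opprK.
have /eqP : (z ^+ label_prod - 1) * (z ^+ label_prod + 1) = 0.
  by transitivity (z ^+ label_prod * z ^+ label_prod - 1); [ring | rewrite zz subrr].
by rewrite mulf_eq0 subr_eq0 (negPf z1).
Qed.

Lemma half_angle_neq0 v w : half_angle v w != 0.
Proof. by rewrite expf_neq0 ?std_root_neq0. Qed.

Lemma half_angleX v w : adj v w -> half_angle v w ^+ m v w = -1.
Proof. by move=> vw; rewrite /half_angle -exprM divnK ?dvdn_label // std_root_label. Qed.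

Lemma natr2_neq0 : 2%:R != 0 :> F.
Proof. by have := prim_root_dvd_eq0 zP (dvdn_mulr label_prod (dvdnn 2)). Qed.

Definition angle v w := half_angle v w * half_angle v w.

Lemma angle_neq1 v w : adj v w -> angle v w != 1.
Proof.
move=> vw; have m2 : (1 < m v w)%N by case: gr => _ [_ [_]]; apply.
rewrite /angle /half_angle -exprD addnn -mul2n -(prim_order_dvd zP) dvdn_pmul2l //.
apply/negP=> /dvdn_leq; rewrite divn_gt0 ?(ltnW m2) // dvdn_leq ?dvdn_label ?label_prod_gt0 //.
by move/(_ isT); rewrite leqNgt ltn_Pdiv ?label_prod_gt0.
Qed.

Lemma angleX v w : adj v w -> angle v w ^+ m v w = 1.
Proof. by move=> vw; rewrite exprMn half_angleX // mulrNN mulr1. Qed.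

Lemma angle_neq0 v w : angle v w != 0.
Proof. by rewrite mulf_neq0 ?half_angle_neq0. Qed.

Lemma angle_sym v w : adj v w -> angle v w = angle w v.
Proof. by move=> vw; rewrite /angle /half_angle; case: gr => _ [_ [-> //]]. Qed.

Lemma std_entry2 v : std_entry v v = 2%:R.
Proof. by rewrite /std_entry eqxx. Qed.

Lemma std_entry_sym v w : std_entry v w = std_entry w v.
Proof.
rewrite /std_entry eq_sym; case: gr => [aS [_ [mS _]]]; rewrite aS.
by case: (w == v) => //; case: ifP => // wv; rewrite /half_angle (mS _ _ wv).
Qed.

Lemma std_entryM v w : adj v w ->
  std_entry v w * std_entry w v = 2%:R + angle v w + (angle v w)^-1.
Proof.
move=> vw; rewrite [std_entry w v]std_entry_sym /std_entry vw.
rewrite coxeter_adj_neq //.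
by rewrite /angle; field; apply: half_angle_neq0.
Qed.

Lemma std_entry0 v w : adj v w -> angle v w = -1 -> std_entry v w = 0.
Proof.
move=> vw e; rewrite /std_entry vw.
rewrite coxeter_adj_neq //.
apply: (mulfI (half_angle_neq0 v w)); rewrite mulrDr -/(angle v w) e mulfV ?half_angle_neq0 //.
by rewrite addNr mulr0.
Qed.

Lemma std_cartan : cartan adj m std_entry.
Proof.
split=> [|v w vw]; first exact: std_entry2.
exists (angle v w); split; rewrite ?angleX ?angle_neq1 ?std_entryM // => e.
by rewrite [std_entry w v]std_entry_sym std_entry0.
Qed.

End StandardCartan.

Lemma prime_coprime_above (n : nat) : (0 < n)%N ->
  exists p, [/\ prime p, odd p & coprime (2 * n) p].
Proof.
move=> n0; have [p np pp] := prime_above (2 * n); exists p.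
have p2 : (2 < p)%N by lia.
split=> //; first by have := even_prime pp; case=> // e; rewrite e in p2.
rewrite coprime_sym prime_coprime //; apply/negP => /dvdn_leq; lia.
Qed.

(** * Exclusion of even labels *)

Section Sign.
Local Open Scope group_scope.

Definition sgn1 : 'Z_2 := Ordinal (isT : 1 < 2)%N.
Definition Z4mod2 (x : 'Z_4) : 'Z_2 := inZp x.
Definition Z2to4 (x : 'Z_2) : 'Z_4 := inZp x.

Lemma Z4mod2M : {morph Z4mod2 : x y / x * y}.
Proof.
by move=> [[|[|[|[|x]]]] hx] [[|[|[|[|y]]]] hy] //; apply/val_inj.
Qed.

Lemma Z2to4K : cancel Z2to4 Z4mod2.
Proof. by move=> [[|[|x]] hx] //; apply/val_inj. Qed.

Lemma Z4mod2_ker x : Z4mod2 x = 1 -> x ^+ 2 = 1.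
Proof. by case: x => [[|[|[|[|x]]]] hx] // _; apply/val_inj. Qed.

Lemma Z2_cases (x : 'Z_2) : x = 1 \/ x = sgn1.
Proof. by case: x => [[|[|x]] hx] //; [left | right]; apply/val_inj. Qed.

Lemma sgn1M : sgn1 * sgn1 = 1. Proof. exact/val_inj. Qed.

End Sign.

Section NoInvolution.
Local Open Scope group_scope.
Variables (V : finType) (rt : V -> V) (mm : V -> nat).
Hypothesis rtK : forall v, rt (rt v) = rt v.
Hypothesis odd_mm : forall v, rt v != v -> odd (mm v).
Variables (V' : finType) (adj' : rel V') (m' : V' -> V' -> nat).
Variable C : forall gT : finGroupType, (V -> gT) -> (V' -> gT) -> Prop.
Hypothesis tC : transfer (star_adj rt) (star_label rt mm) adj' m' C.

Variables (Q : finGroupType) (eps : Q -> 'Z_2) (t : V -> Q) (t' : V' -> Q).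
Hypotheses (epsM : {morph eps : x y / x * y}) (Ct : C t t').
Hypothesis eps_t : forall v, eps (t v) = sgn1.

(* [x] is a word in the images of the generators; it is not conjugate to any [t v],
   so the [t v] act freely on the cosets of [<[x]>] and an extension by a 2-group
   in which [x] does not lift to an involution can be lifted along [t]. *)
Lemma no_even_involution (word : forall gT : finGroupType, (V' -> gT) -> gT) :
  (forall (gT hT : finGroupType) (f : gT -> hT) (u : V' -> gT) (u' : V' -> hT),
     {morph f : x y / x * y} -> (forall v, f (u v) = u' v) ->
     fin_rel adj' m' u -> f (word gT u) = word hT u') ->
  (forall (gT : finGroupType) (u : V' -> gT), fin_rel adj' m' u ->
     word gT u * word gT u = 1) ->
  eps (word Q t') = 1 -> word Q t' = 1.
Proof.
move=> wordM word2; set x := word Q t' => ex1; apply/eqP/negPn/negP => x1.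
have [Rt Rt'] := transfer_rel tC Ct.
have xx : x * x = 1 by apply: word2.
have Hx q : q \in <[x]> -> q = 1 \/ q = x.
  case/cycleP=> i ->; rewrite (divn_eq i 2) expgD mulnC expgM.
  have -> : x ^+ 2 = 1 by rewrite expgS expg1.
  rewrite expg1n mul1g modn2; case: odd; [right | left] => //=.
pose h (q : Q) : 'Z_2 := if q == 1 then 1 else sgn1.
have hM : {in <[x]> &, {morph h : q r / q * r}}.
  move=> q r /Hx[] -> /Hx[] ->; rewrite /h ?mulg1 ?mul1g ?xx ?eqxx ?(negPf x1);
    exact/val_inj.
pose f v := coind <[x]>%G h (t v).
have Cf := transfer_nat tC (coindM hM) Ct.
have [/(star_relP mm rtK) Rf _] := transfer_rel tC Cf.
have eps1 : eps 1 = 1 by apply: morph_one.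
have epsV q : eps q^-1 = (eps q)^-1.
  by apply: (mulgI (eps q)); rewrite -epsM !mulgV.
have free v A : (f v).2 A = A -> (f v).1 A = 1.
  rewrite permE ffunE /coind_cocycle; case: ifP => // /lcosetsP[y _ ->] e.
  have : (t v) ^ y \in <[x]>.
    have : t v * y \in y *: <[x]> by rewrite -e mem_lcoset mulKg lcoset_refl.
    by rewrite mem_lcoset /conjg mulgA.
  case/Hx => /(congr1 eps); rewrite ?ex1 ?eps1 conjgE !epsM epsV eps_t;
    by case: (Z2_cases (eps y)) => ->.
have [|v|u Ru pu] := lift_star (wreath_mapM (X := {set Q}) Z4mod2M)
    (n := 2) (wreath_map_ker Z4mod2_ker) rtK _ Rf.
- by move=> v rtv; rewrite coprimen2 odd_mm //; have := odd_mm rtv; case: (mm v).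
- have [a aa pa] := wreath_lift_involution Z4mod2M Z2to4K (b := f v) (Rf.1 v) (free v).
  by exists a.
have [u' Ru' pu'] := transfer_lift tC (wreath_mapM (X := {set Q}) Z4mod2M) Cf
  ((star_relP mm rtK _).2 Ru) pu.
(* [word] is uniform in the group, so it can be evaluated at the lifted tuple. At the coset [<[x]>]
   the result gives an element of ['Z_4] over [sgn1] with trivial square, which does not exist. *)
pose y := word _ u'; have yy : y * y = 1 by apply: word2.
have py : wreath_map Z4mod2 y = coind <[x]>%G h x.
  rewrite (wordM _ _ _ u' (coind <[x]>%G h \o t') (wreath_mapM Z4mod2M)) //.
  by rewrite -(wordM _ _ _ t' (coind <[x]>%G h \o t') (coindM hM)).
have y2 : y.2 (<[x]> : {set Q}) = <[x]>.
  have := congr1 (fun b : wreath _ _ => b.2 (<[x]> : {set Q})) py.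
  by rewrite coind_fix ?cycle_id.
have y1 : Z4mod2 (y.1 (<[x]> : {set Q})) = sgn1.
  have := congr1 (fun b : wreath _ _ => b.1 (<[x]> : {set Q})) py.
  by rewrite coind_val ?cycle_id // /h (negPf x1) ffunE.
have : y.1 (<[x]> : {set Q}) * y.1 (<[x]> : {set Q}) = 1.
  by rewrite -wreath1_fix // yy ffunE.
by move: y1; case: (y.1 _) => [[|[|[|[|i]]]] hi].
Qed.

End NoInvolution.

Section NoEvenLabel.
Variables (V : finType) (rt : V -> V) (mm : V -> nat).
Hypothesis rtK : forall v, rt (rt v) = rt v.
Hypothesis odd_mm : forall v, rt v != v -> odd (mm v).
Variables (V' : finType) (adj' : rel V') (m' : V' -> V' -> nat).
Variable C : forall gT : finGroupType, (V -> gT) -> (V' -> gT) -> Prop.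
Hypothesis tC : transfer (star_adj rt) (star_label rt mm) adj' m' C.
Hypothesis gr' : coxeter_graph adj' m'.

(** If [m' v w] were even, the generator of [v], the half turn (v w)^(m/2) and their product would
    be commuting involutions. The sign [chi] is trivial on one of them, so [no_even_involution]
    kills it in the reflection representation, which is however nontrivial on all three. *)
Theorem transfer_odd_labels : odd_labels adj' m'.
Proof.
move=> v w vw; apply/negPn/negP => ev.
have [p [pp op np]] := prime_coprime_above (label_prod_gt0 gr').
have N0 : (0 < 2 * label_prod adj' m')%N by rewrite muln_gt0 label_prod_gt0.
have [F [pF _ [z zP]]] := finfield_of_order pp N0 np (isT : 0 < 1)%N.
pose A := std_entry adj' m' z; have A2 : forall v, A v v = 2%:R by apply: std_entry2.
have F2 := natr2_neq0 zP.
have Rrho := refl_fin_rel A2 gr' (std_cartan gr' zP).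
pose k := (m' v w)./2; have mk : m' v w = k.*2.
  by rewrite -[LHS]odd_double_half (negPf ev).
pose a := angle adj' m' z v w; have ak : a ^+ k = -1.
  by rewrite /a /angle exprMn -exprD addnn -mk half_angleX.
have a0 : a != 0 by apply: angle_neq0.
have a1 : a != 1 by apply: angle_neq1.
have Aa : A v w * A w v = 2%:R + a + a^-1 by apply: std_entryM.
have aN : a = -1 -> A v w = 0 /\ A w v = 0.
  by move=> e; rewrite [A w v]std_entry_sym // /A std_entry0.
Local Open Scope group_scope.
have Rsg : fin_rel (star_adj rt) (star_label rt mm) (fun=> sgn1).
  apply/star_relP=> //; split=> [u|u rtu]; first exact: sgn1M.
  rewrite gpow_expg /=; have -> : sgn1 * sgn1 = 1 by exact: sgn1M.
  by rewrite expg1n.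
have [chi Cchi] := transfer_l tC Rsg.
have [_ [chi2 _]] := transfer_rel tC Cchi.
(* Pairing with [chi] makes the sign of [W_Gamma] visible on the finite target, as the second
   projection. *)
pose g u := (refl A2 u, chi u).
have Rg : fin_rel adj' m' g.
  case: Rrho => r2 rm; have [_ [_ cm]] := transfer_rel tC Cchi.
  split=> [u|u u' uu']; first by congr pair; [exact: r2 | exact: chi2].
  rewrite gpow_expg; have X (x : ({perm {ffun V' -> F}} * 'Z_2)%type) n :
    x ^+ n = (x.1 ^+ n, x.2 ^+ n).
    by elim: n => [|n IHn] //; rewrite !expgS IHn.
  have := rm u u' uu'; have := cm u u' uu'.
  by rewrite !gpow_expg X => e1 e2; congr pair.
have [t Ct] := transfer_r tC Rg.
have sndM : {morph (fun x : ({perm {ffun V' -> F}} * 'Z_2)%type => x.2) : x y / x * y} by [].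
have eps_t u : (t u).2 = sgn1.
  exact: (transfer_inj tC (transfer_nat tC sndM Ct) Cchi (fun=> erefl) u).
(* [word b c] runs through the Klein four-group. *)
pose word (b c : bool) (gT : finGroupType) (u : V' -> gT) :=
  (if b then u v else 1) * (if c then (u v * u w) ^+ k else 1).
have wordM b c (gT hT : finGroupType) (f : gT -> hT) (u : V' -> gT) (u' : V' -> hT) :
    {morph f : x y / x * y} -> (forall v, f (u v) = u' v) ->
    f (word b c gT u) = word b c hT u'.
  move=> fM fu; have f1 := morph_one fM; rewrite /word fM.
  by case: b; case: c; rewrite ?f1 ?(morph_exp fM) ?fM ?fu.
have word2 b c (gT : finGroupType) (u : V' -> gT) : fin_rel adj' m' u ->
    word b c gT u * word b c gT u = 1.
  case=> u2 um; have {um} := um v w vw; rewrite gpow_expg /= => uvw.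
  have vv : u v * u v = 1 by apply: u2.
  have ww : u w * u w = 1 by apply: u2.
  rewrite /word; set r := _ ^+ k; have rr : r * r = 1.
    by rewrite -expgD addnn -mk.
  have vr : u v * r * u v = r.
    by rewrite rot_conj //; apply/eqP; rewrite eq_invg_mul rr.
  case: b; case: c; rewrite ?mul1g ?mulg1 //.
  by rewrite mulgA vr rr.
have key b c : (word b c _ g).2 = 1 -> (word b c _ g).1 = 1.
  move=> e; rewrite (no_even_involution rtK odd_mm tC sndM Ct eps_t (word := word b c)) //.
    by move=> gT hT f u u' fM fu _; apply: wordM.
  exact: word2.
have word1 b c : (word b c _ g).1 = word b c _ (refl A2).
  exact: (wordM b c _ _ (fun x : ({perm {ffun V' -> F}} * 'Z_2)%type => x.1)).
have word_chi b c : (word b c _ g).2 = word b c _ chi.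
  exact: (wordM b c _ _ (fun x : ({perm {ffun V' -> F}} * 'Z_2)%type => x.2)).
have nv : word true false _ chi <> 1.
  move=> e; have := refl_neq1 A2 F2 v; rewrite -[refl A2 v]mulg1.
  by rewrite -[_ * _]/(word true false _ (refl A2)) -word1 key ?eqxx ?word_chi.
have nr : word false true _ chi <> 1.
  move=> e; have := rot_half_neq1 A2 F2 a0 a1 Aa aN ak; rewrite -[_ ^+ k]mul1g.
  by rewrite -[_ * _]/(word false true _ (refl A2)) -word1 key ?eqxx ?word_chi.
have nvr : word true true _ chi <> 1.
  move=> e; have := refl_rot_half_neq1 A2 a0 a1 Aa aN ak.
  by rewrite -[_ * _]/(word true true _ (refl A2)) -word1 key ?eqxx ?word_chi.
have wordTT : word true true _ chi = word true false _ chi * word false true _ chi.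
  by rewrite /word mulg1 mul1g.
case: (Z2_cases (word true false _ chi)) => // e1.
case: (Z2_cases (word false true _ chi)) => // e2.
by apply: nvr; rewrite wordTT e1 e2 sgn1M.
Qed.

End NoEvenLabel.

(** * The Heisenberg extension of the affine plane *)

Definition heis_det (F : finFieldType) (x : F * (F * F) * (F * F * F * F)) :=
  let: (_, _, (a, b, c, d)) := x in a * d - b * c.
Definition heis (F : finFieldType) := {x : F * (F * F) * (F * F * F * F) | heis_det x != 0}.
HB.instance Definition _ (F : finFieldType) := Finite.on (heis F).

(* [(z, u, M)] stands for the affine map [y |-> y M + u] of the plane of row vectors,
   extended by a central coordinate on which [M] acts through its determinant. *)
Section Heisenberg.
Variable F : finFieldType.
Local Notation raw := (F * (F * F) * (F * F * F * F))%type.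

Definition heis_mul_raw (x y : raw) : raw :=
  let: (z, (u, v), (a, b, c, d)) := x in
  let: (z', (u', v'), (a', b', c', d')) := y in
  let u1 := u * a' + v * c' in let v1 := u * b' + v * d' in
  (z' + (a' * d' - b' * c') * z + (u1 * v' - v1 * u'), (u1 + u', v1 + v'),
   (a * a' + b * c', a * b' + b * d', c * a' + d * c', c * b' + d * d')).

Definition heis_inv_raw (x : raw) : raw :=
  let: (z, (u, v), (a, b, c, d)) := x in
  let e := a * d - b * c in
  (- z / e, (- (u * d - v * c) / e, - (v * a - u * b) / e),
   (d / e, - b / e, - c / e, a / e)).

Lemma heis_det_mul x y : heis_det (heis_mul_raw x y) = heis_det x * heis_det y.
Proof.
by case: x y => [[z [u v]] [[[a b] c] d]] [[z' [u' v']] [[[a' b'] c'] d']] /=; ring.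
Qed.

Lemma heis_det_inv x : heis_det x != 0 -> heis_det (heis_inv_raw x) != 0.
Proof.
case: x => [[z [u v]] [[[a b] c] d]] /= e0.
have -> : d / (a * d - b * c) * (a / (a * d - b * c)) -
  - b / (a * d - b * c) * (- c / (a * d - b * c)) = (a * d - b * c)^-1 by field.
by rewrite invr_eq0.
Qed.

Lemma heis_mul_subproof (x y : heis F) : heis_det (heis_mul_raw (val x) (val y)) != 0.
Proof. by rewrite heis_det_mul mulf_neq0 ?(valP x) ?(valP y). Qed.

Lemma heis_one_subproof : heis_det ((0, (0, 0), (1, 0, 0, 1)) : raw) != 0.
Proof. by rewrite /= mul1r mul0r subr0 oner_neq0. Qed.

Definition heis_mul (x y : heis F) : heis F := exist (fun x => is_true (heis_det x != 0)) _ (heis_mul_subproof x y).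
Definition heis_one : heis F := exist (fun x => is_true (heis_det x != 0)) _ heis_one_subproof.
Definition heis_inv (x : heis F) : heis F := exist (fun x => is_true (heis_det x != 0)) _ (heis_det_inv (valP x)).

Lemma heis_mulA : associative heis_mul.
Proof.
move=> x y w; apply: val_inj => /=.
case: (val x) (val y) (val w) => [[z [u v]] [[[a b] c] d]]
  [[z' [u' v']] [[[a' b'] c'] d']] [[z2 [u2 v2]] [[[a2 b2] c2] d2]] /=.
by congr (_, (_, _), (_, _, _, _)); ring.
Qed.

Lemma heis_mul1 : left_id heis_one heis_mul.
Proof.
move=> x; apply: val_inj => /=; case: (val x) => [[z [u v]] [[[a b] c] d]] /=.
by congr (_, (_, _), (_, _, _, _)); ring.
Qed.

Lemma heis_mulV : left_inverse heis_one heis_inv heis_mul.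
Proof.
case=> -[[z [u v]] [[[a b] c] d]] e0; apply: val_inj => /=; rewrite /= in e0.
by congr (_, (_, _), (_, _, _, _)); field.
Qed.

HB.instance Definition _ := Finite_isGroup.Build (heis F) heis_mulA heis_mul1 heis_mulV.

Lemma val_heisM (x y : heis F) : val (x * y)%g = heis_mul_raw (val x) (val y).
Proof. by []. Qed.

Lemma val_heis1 : val (1%g : heis F) = (0, (0, 0), (1, 0, 0, 1)).
Proof. by []. Qed.

Definition heis_act_fun (x : heis F) (y : F * F) : F * F :=
  let: (_, (u, v), (a, b, c, d)) := val x in
  (y.1 * a + y.2 * c + u, y.1 * b + y.2 * d + v).

Lemma heis_act_funM x y : heis_act_fun (x * y)%g =1 heis_act_fun y \o heis_act_fun x.
Proof.
move=> [p q]; rewrite /heis_act_fun val_heisM /=.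
case: (val x) (val y) => [[z [u v]] [[[a b] c] d]] [[z' [u' v']] [[[a' b'] c'] d']] /=.
by congr pair; ring.
Qed.

Lemma heis_act_fun1 y : heis_act_fun 1%g y = y.
Proof. by case: y => p q; rewrite /heis_act_fun val_heis1 /=; congr pair; ring. Qed.

Lemma heis_act_inj x : injective (heis_act_fun x).
Proof.
apply: (can_inj (g := heis_act_fun x^-1%g)) => y.
by rewrite -[LHS]/((heis_act_fun x^-1%g \o heis_act_fun x) y) -heis_act_funM mulgV heis_act_fun1.
Qed.

Definition heis_act (x : heis F) : {perm F * F} := perm (@heis_act_inj x).

Lemma heis_actM : {morph heis_act : x y / (x * y)%g}.
Proof. by move=> x y; apply/permP=> w; rewrite permM !permE heis_act_funM. Qed.

Lemma heis_act_eq x y : heis_act x = heis_act y -> (val x).1.2 = (val y).1.2 /\ (val x).2 = (val y).2.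
Proof.
move=> /permP e; move: (e (0, 0)) (e (1, 0)) (e (0, 1)); rewrite !permE /heis_act_fun.
case: (val x) (val y) => [[z [u v]] [[[a b] c] d]] [[z' [u' v']] [[[a' b'] c'] d']] /=.
rewrite !mul0r !mul1r !add0r !addr0 => -[-> ->] [/addIr -> /addIr ->] [/addIr -> /addIr ->].
by [].
Qed.

Lemma heis_linearX (x : heis F) n : (val x).1.2 = (0, 0) -> heis_det (val x) = 1 ->
  [/\ (val (x ^+ n)%g).1.1 = (val x).1.1 *+ n, (val (x ^+ n)%g).1.2 = (0, 0) &
      heis_det (val (x ^+ n)%g) = 1].
Proof.
move=> xu xd; elim: n => [|n [IHz IHu IHd]].
  by rewrite val_heis1 /= mulr0n mul1r mul0r subr0.
rewrite expgS val_heisM heis_det_mul xd IHd mulr1; move: IHz IHu IHd xu.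
case: (val x) (val _) => [[z [u v]] [[[a b] c] d]] [[z' [u' v']] [[[a' b'] c'] d']] /=.
move=> -> [-> ->] -> [-> ->]; rewrite mulrSr; split=> //; last congr pair; ring.
Qed.

Lemma heis_mul_reflections (x y : heis F) : (val x).1.2 = (0, 0) ->
  heis_det (val x) = -1 -> heis_det (val y) = -1 ->
  [/\ (val (x * y)%g).1.1 = (val y).1.1 - (val x).1.1,
      (val (x * y)%g).1.2 = (val y).1.2 & heis_det (val (x * y)%g) = 1].
Proof.
rewrite val_heisM heis_det_mul => xu xd yd; split; last by rewrite xd yd mulrNN mulr1.
  move: xu xd yd.
  case: (val x) (val y) => [[z [u v]] [[[a b] c] d]] [[z' [u' v']] [[[a' b'] c'] d']] /=.
  by move=> [-> ->] _ ->; ring.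
move: xu; case: (val x) (val y) => [[z [u v]] [[[a b] c] d]] [[z' [u' v']] [[[a' b'] c'] d']] /=.
by move=> [-> ->]; congr pair; ring.
Qed.

(** Conjugating by a translation that moves [y] to the origin turns [x] into a linear element whose
    central coordinate is the displayed sum; its [n]-th power multiplies that coordinate by [n]. *)
Lemma heis_fixpoint_expg (x : heis F) (y : F * F) n :
  heis_det (val x) = 1 -> heis_act_fun x y = y -> (x ^+ n = 1)%g ->
  ((val x).1.1 + (y.1 * (val x).1.2.2 - y.2 * (val x).1.2.1)) *+ n = 0.
Proof.
move=> xd xy xn.
have c1 : heis_det (0, y, (1, 0, 0, 1) : F * F * F * F) != 0.
  by case: y {xy} => a b; rewrite /= mul1r mul0r subr0 oner_neq0.
have d1 : heis_det ((val x).1.1 + (y.1 * (val x).1.2.2 - y.2 * (val x).1.2.1), (0, 0), (val x).2) = 1.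
  by rewrite -[RHS]xd; case: (val x) => [[z [u v]] [[[a b] c] d]].
have d0 : heis_det ((val x).1.1 + (y.1 * (val x).1.2.2 - y.2 * (val x).1.2.1), (0, 0), (val x).2) != 0.
  by rewrite d1 oner_neq0.
pose c : heis F := exist (fun x => is_true (heis_det x != 0)) _ c1.
pose d : heis F := exist (fun x => is_true (heis_det x != 0)) _ d0.
have dc : (d * c = c * x)%g.
  apply: val_inj; rewrite !val_heisM -[val c]/(0, y, (1, 0, 0, 1)).
  rewrite -[val d]/((val x).1.1 + (y.1 * (val x).1.2.2 - y.2 * (val x).1.2.1), (0, 0), (val x).2).
  move: xd xy; rewrite /heis_act_fun; case: y {c1 d1 d0 c d} => p q; case: (val x) => [[z [u v]] [[[a b] c] d]] /= xd [py qy].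
  congr (_, (_, _), (_, _, _, _)); try ring.
  - transitivity (z + ((p * a + q * c + u) * v - (p * b + q * d + v) * u)).
      by rewrite py qy; ring.
    by rewrite xd; ring.
  - by rewrite py; ring.
  - by rewrite qy; ring.
have dE : (d = x ^ c^-1)%g by rewrite conjgE invgK mulgA -dc mulgK.
have [e _ _] := heis_linearX (x := d) n erefl d1.
by rewrite -[RHS]/(val (1%g : heis F)).1.1 -(conj1g c^-1%g) -xn conjXg -dE e.
Qed.

Variable p : nat.
Hypothesis pF : p \in [pchar F].

Lemma heis_act_ker (x : heis F) : heis_act x = 1%g -> (x ^+ p = 1)%g.
Proof.
move=> x1; have pw n : val (x ^+ n)%g = ((val x).1.1 *+ n, (0, 0), (1, 0, 0, 1)).
  have [e1 e2] : (val x).1.2 = (0, 0) /\ (val x).2 = (1, 0, 0, 1).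
    have E1 : heis_act 1%g = 1%g.
      by apply/permP=> w; rewrite permE perm1 heis_act_fun1.
    by rewrite -E1 in x1; have [-> ->] := heis_act_eq x1.
  elim: n => [|n IHn]; first by rewrite val_heis1.
  rewrite expgS val_heisM IHn; move: e1 e2.
  case: (val x) => [[z [u v]] [[[a b] c] d]] /= [-> ->] [-> -> -> ->].
  by rewrite mulrSr; congr (_, (_, _), (_, _, _, _)); ring.
by apply: val_inj; rewrite pw val_heis1 -mulr_natr (pcharf0 pF) mulr0.
Qed.

End Heisenberg.

(** * Plane reflections along a cycle *)

Section RankOne.
Variable F : fieldType.

(** The matrix with rows (1 - a, -b) and (-c, 1 + a) is singular, hence a column times a row. It is
    1 - S for a traceless S with S^2 = 1, that is, for a plane reflection S. *)
Lemma rank_one_factor (a b c : F) : 2%:R != 0 :> F -> a * a = 1 - b * c ->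
  exists e1 e2 p1 p2 : F, [/\ e1 * p1 = 1 - a, e1 * p2 = - b, e2 * p1 = - c & e2 * p2 = 1 + a].
Proof.
move=> F2 aa; have [a1|a1] := eqVneq (1 - a) 0.
  have {}a1 : a = 1 by apply/esym/eqP; rewrite -subr_eq0 a1.
  have bc : b * c = 0 by rewrite -[b * c](subKr 1) -aa a1 mulr1 subrr.
  exists (- b / 2%:R), 1, (- c), 2%:R; rewrite a1 subrr !mul1r; split=> //.
  - by rewrite mulrAC mulrNN bc mul0r.
  - by rewrite divfK.
exists 1, (- c / (1 - a)), (1 - a), (- b); rewrite !mul1r; split=> //; first by rewrite divfK.
have -> : - c / (1 - a) * - b = b * c / (1 - a) by field.
have -> : b * c = (1 - a) * (1 + a) by rewrite -[LHS](subKr 1) -aa; ring.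
by field.
Qed.

Lemma inv_trace_neq2 (x : F) : x != 0 -> x != 1 -> 2%:R - (x + x^-1) != 0.
Proof.
move=> x0 x1; have -> : 2%:R - (x + x^-1) = - (x - 1) ^+ 2 / x by field.
by rewrite !mulf_neq0 ?invr_eq0 // oppr_eq0 expf_neq0 // subr_eq0.
Qed.

Lemma odd_root_sq (x : F) n : odd n -> x ^+ n = 1 -> x * x = 1 -> x = 1.
Proof.
move=> on xn xx; rewrite -xn -(odd_double_half n) on exprD expr1 -muln2 mulnC exprM.
by rewrite expr2 xx expr1n mulr1.
Qed.

Variables (k N : nat) (ang : nat -> F).
Hypotheses (k2 : (2 < k)%N) (oN : odd N).
Hypotheses (angN : forall i, (i < k)%N -> ang i ^+ N = 1).
Hypotheses (ang1 : forall i, (i < k)%N -> ang i != 1).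

Lemma ang_neq0 i : (i < k)%N -> ang i != 0.
Proof.
move=> ik; apply/eqP=> a0; move: (angN ik); rewrite a0 expr0n.
by case: (N) oN => // n _ /esym/eqP; rewrite oner_eq0.
Qed.

(* A chain of reflections in one dihedral group of the plane, consecutive ones being
   at angle [ang i]; the direction of the last step is chosen so that the chain does
   not close up. *)
Lemma dihedral_chain : exists t : nat -> F,
  [/\ t 1 = 1, forall i, (0 < i < k)%N -> t i ^+ N = 1,
      forall i, (0 < i)%N -> (i.+1 < k)%N -> t i / t i.+1 = ang i \/ t i.+1 / t i = ang i &
      t k.-1 != 1].
Proof.
pose u := fix u i := if i is j.+1 then (if j == 0%N then 1 else u j / ang j) else 1.
have uS i : (0 < i)%N -> u i.+1 = u i / ang i by case: i.
have uN i : (i <= k)%N -> u i ^+ N = 1.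
  elim: i => [|i IHi] ik; first by rewrite expr1n.
  have [->|i0] := posnP i; first by rewrite expr1n.
  by rewrite uS // expr_div_n IHi ?angN ?divr1 // ltnW.
have u0 i : (i <= k)%N -> u i != 0.
  move=> /uN; apply: contra_eq_neq => ->; rewrite expr0n.
  by case: (N) oN => // n _; rewrite eq_sym oner_eq0.
have [u1|u1] := eqVneq (u k.-1) 1; last first.
  exists u; split=> // [i /andP[_ /ltnW/uN]//|i i0 ik]; left.
  have ui := u0 i (ltnW (ltnW ik)); have ai := ang_neq0 (ltnW ik).
  by rewrite uS //; field; apply/andP.
pose l := k.-2; have kl : k.-1 = l.+1 by rewrite /l; lia.
have l0 : (0 < l)%N by rewrite /l; lia.
have lk : (l.+1 < k)%N by rewrite /l; lia.
exists (fun i => if i == k.-1 then u l * ang l else u i); split.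
- by case: eqP => //; lia.
- move=> i /andP[_ ik]; case: ifP => _; last by rewrite uN // ltnW.
  by rewrite exprMn uN ?angN ?mulr1 //; lia.
- move=> i i0 ik; rewrite !kl; case: eqP => [|_]; first by lia.
  have ui := u0 i (ltnW (ltnW ik)); have ai := ang_neq0 (ltnW ik).
  case: eqP => [[<-]|_]; first by right; rewrite mulrAC divff ?mul1r.
  by left; rewrite uS //; field; apply/andP.
(* Had both directions of the last step closed the chain, [ang l] would square to 1, which is
   impossible for a nontrivial root of odd order. *)
- rewrite eqxx; apply/eqP => e; move: u1; rewrite kl uS // => e'.
  have al := ang_neq0 (ltnW lk).
  have aa : ang l * ang l = 1.
    have ue : u l = ang l by rewrite -[LHS](divfK al) e' mul1r.
    by rewrite -{1}ue.
  by move/eqP: (ang1 (ltnW lk)); apply; apply: odd_root_sq oN (angN (ltnW lk)) aa.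
Qed.

Variable f : {rmorphism F -> F}.
Hypothesis fix_root : forall x, x ^+ N = 1 -> f x = x.
Hypothesis fix_sqrt : forall x, f x = x -> exists y, y * y = x.
Hypothesis F2 : 2%:R != 0 :> F.

Lemma plane_reflections : exists ex ey px py : nat -> F,
  let pr i j := px i * ex j + py i * ey j in
  [/\ forall i, (i < k)%N -> pr i i = 2%:R,
      forall i j, (i < k)%N -> (j < k)%N -> j = i.+1 \/ (i = k.-1 /\ j = 0%N) ->
         pr i j * pr j i = 2%:R + ang i + (ang i)^-1,
      px 1 * py k.-1 - py 1 * px k.-1 != 0 &
      exists y1 y2 : F * F,
        [/\ px 1 * y1.1 + py 1 * y1.2 = 0, px 0 * y1.1 + py 0 * y1.2 = 1,
            px k.-1 * y2.1 + py k.-1 * y2.2 = 0, px 0 * y2.1 + py 0 * y2.2 = 1 &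
            y1.1 * ey 0 - y1.2 * ex 0 != y2.1 * ey 0 - y2.2 * ex 0]].
Proof.
have [t [t1 tN tS tk]] := dihedral_chain.
have k1 : (0 < k.-1 < k)%N by lia.
have t0 i : (0 < i < k)%N -> t i != 0.
  move=> /tN; apply: contra_eq_neq => ->; rewrite expr0n.
  by case: (N) oN => // n _; rewrite eq_sym oner_eq0.
pose s := t k.-1; have s0 : s != 0 by apply: t0; lia.
have ss : s^-1 - s != 0.
  apply: contra tk => /eqP e; apply/eqP; apply: odd_root_sq oN (tN _ k1) _.
  have -> : t k.-1 * t k.-1 = 1 - s * (s^-1 - s) by rewrite -/s; field.
  by rewrite e mulr0 subr0.
pose tau0 := ang 0 + (ang 0)^-1; pose tau' := ang k.-1 + (ang k.-1)^-1.
have a00 : ang 0 != 0 by apply: ang_neq0; lia.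
have ak0 : ang k.-1 != 0 by apply: ang_neq0; lia.
pose b := (tau' - s * tau0) / (s^-1 - s); pose c := tau0 - b.
have [a aa] : exists a, a * a = 1 - b * c.
  have fa0 : f (ang 0) = ang 0 by apply/fix_root/angN; lia.
  have fak : f (ang k.-1) = ang k.-1 by apply/fix_root/angN; lia.
  have fs : f s = s by apply/fix_root/tN.
  apply: fix_sqrt; rewrite /c /b /tau0 /tau'.
  have fV x : f x^-1 = (f x)^-1 by apply: fmorphV.
  by do 3!rewrite ?(rmorphB,rmorphM,rmorphD,fV,rmorph1) ?fa0 ?fak ?fs /=.
have [e1 [e2 [p1 [p2 [E1 E2 E3 E4]]]]] := rank_one_factor F2 aa.
have bc0 : b + c = tau0 by rewrite /c; ring.
have bck : b / s + c * s = tau'.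
  rewrite /c; have -> : b / s + (tau0 - b) * s = b * (s^-1 - s) + s * tau0 by ring.
  by rewrite /b divfK // subrK.
exists (fun i => if i == 0%N then e1 else - t i), (fun i => if i == 0%N then e2 else 1),
  (fun i => if i == 0%N then p1 else - (t i)^-1), (fun i => if i == 0%N then p2 else 1).
have kE : (k.-1 == 0%N) = false by lia.
move=> pr; split.
- move=> [|i] ik; rewrite /pr /= ?mulrNN ?mulVf ?t0 //; last by ring.
  by rewrite ![p1 * _]mulrC ![p2 * _]mulrC E1 E4; ring.
- move=> i j ik jk [ej|[-> ->]].
    rewrite {}ej in jk *.
    case: i ik jk => [|i] ik jk; rewrite /pr /=.
      rewrite t1 invr1; transitivity (2%:R + (b + c)); last by rewrite bc0 /tau0; ring.
      transitivity (e1 * p1 + e2 * p2 - e1 * p2 - e2 * p1); first by ring.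
      by rewrite E1 E2 E3 E4; ring.
    have ti : t i.+1 != 0 by apply: t0; lia.
    have ti' : t i.+2 != 0 by apply: t0; lia.
    transitivity (2%:R + t i.+1 / t i.+2 + t i.+2 / t i.+1); first by field; apply/andP.
    have inv (x y : F) : x != 0 -> y != 0 -> x / y = (y / x)^-1 by move=> x0 y0; field; apply/andP.
    by case: (tS i.+1 isT jk) => [e|e]; [rewrite [t i.+2 / _]inv // e | rewrite [t i.+1 / _]inv // e addrAC].
  rewrite /pr kE /= -/s.
  transitivity (2%:R + (b / s + c * s)); last by rewrite bck /tau'; ring.
  transitivity (e1 * p1 + e2 * p2 - (e1 * p2) / s - (e2 * p1) * s); first by field.
  by rewrite E1 E2 E3 E4; ring.
- rewrite kE /= t1 invr1 -/s; have -> : -1 * 1 - 1 * - s^-1 = (1 - s) / s by field.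
  by rewrite mulf_neq0 ?invr_eq0 // subr_eq0 eq_sym.
rewrite kE; have A1 : p1 + p2 != 0.
  have: (e1 + e2) * (p1 + p2) != 0.
    have -> : (e1 + e2) * (p1 + p2) = 2%:R - tau0.
      transitivity (e1 * p1 + e1 * p2 + e2 * p1 + e2 * p2); first by ring.
      by rewrite E1 E2 E3 E4 -bc0; ring.
    by apply: inv_trace_neq2 => //; apply: ang1; lia.
  by rewrite mulf_eq0 negb_or => /andP[].
have A2 : s * p1 + p2 != 0.
  have: (e1 + s * e2) * (s * p1 + p2) / s != 0.
    have -> : (e1 + s * e2) * (s * p1 + p2) / s = 2%:R - tau'.
      transitivity (e1 * p1 + e1 * p2 / s + e2 * p1 * s + e2 * p2); first by field.
      by rewrite E1 E2 E3 E4 -bck; ring.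
    by apply: inv_trace_neq2 => //; apply: ang1; lia.
  by rewrite !mulf_eq0 !negb_or -andbA => /and3P[].
exists (1 / (p1 + p2), 1 / (p1 + p2)), (s / (s * p1 + p2), 1 / (s * p1 + p2)).
rewrite /= t1 invr1 -/s; split; [by field | by field | by field; apply/andP | by field | ].
apply/eqP => e.
have : ((e2 - e1) * (s * p1 + p2) - (s * e2 - e1) * (p1 + p2)) = 0.
  have -> : (e2 - e1) * (s * p1 + p2) - (s * e2 - e1) * (p1 + p2) =
    (p1 + p2) * (s * p1 + p2) * ((1 / (p1 + p2) * e2 - 1 / (p1 + p2) * e1) -
      (s / (s * p1 + p2) * e2 - 1 / (s * p1 + p2) * e1)) by field; apply/andP.
  by rewrite e subrr mulr0.
have -> : (e2 - e1) * (s * p1 + p2) - (s * e2 - e1) * (p1 + p2) =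
  (1 - s) * (e1 * p1 + e2 * p2) by ring.
rewrite E1 E4; have -> : 1 - a + (1 + a) = 2%:R by ring.
by move/eqP; rewrite mulf_eq0 (negPf F2) orbF subr_eq0 eq_sym (negPf tk).
Qed.

End RankOne.

Local Close Scope ring_scope.

Lemma cycle_nthP (V : eqType) (e : rel V) (x0 : V) (s : seq V) : 0 < size s ->
  reflect ((forall i, i.+1 < size s -> e (nth x0 s i) (nth x0 s i.+1)) /\
           e (nth x0 s (size s).-1) (nth x0 s 0)) (path.cycle e s).
Proof.
case: s => // x p _; rewrite /= rcons_path (last_nth x0).
by apply: (iffP andP) => -[]; [move/(pathP x0) | move=> ? ?; split => //; apply/(pathP x0)].
Qed.

(** A cycle of least length has no chord: a chord between [c i] and [c j] would close the shorter
    stretch from i to j into a cycle. *)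
Lemma chordless_cycle (V : finType) (adj : rel V) :
  (forall v w, adj v w = adj w v) -> ~ forest adj ->
  exists k (c : nat -> V), [/\ 2 < k, {in gtn k &, injective c} &
    forall i j, i < j < k -> adj (c i) (c j) = (j == i.+1) || (i == 0) && (j == k.-1)].
Proof.
move=> adjC nf.
pose P k := [exists s : k.-tuple V, [&& 2 < k, uniq s & path.cycle adj s]].
have exP : exists k, P k.
  apply: NNPP => noP; apply: nf => p Up p3; apply/negP => Cp; apply: noP.
  by exists (size p); apply/existsP; exists (in_tuple p); rewrite /= p3 Up.
case: (ex_minnP exP) => k /existsP[s /and3P[k2 Us Cs]] kmin.
have [x0 _] : exists x0 : V, True by case: s {Us Cs} => -[|x s] /= /eqP sk; [rewrite -sk in k2 | exists x].
pose c := nth x0 s; have sk := size_tuple s.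
have cI : {in gtn k &, injective c}.
  by move=> i j ik jk /eqP; rewrite /c nth_uniq ?sk // => /eqP.
have [|Cs1 Cs2] := cycle_nthP adj x0 (s := s) _ Cs; first by rewrite sk; lia.
rewrite -/c sk in Cs1 Cs2.
have {}kmin n (d : nat -> V) : 2 < n -> {in gtn n &, injective d} ->
    (forall i, i.+1 < n -> adj (d i) (d i.+1)) -> adj (d n.-1) (d 0) -> k <= n.
  move=> n2 dI d1 d2; apply: kmin; apply/existsP.
  have sz : size (mkseq d n) == n by rewrite size_mkseq.
  exists (Tuple sz); rewrite n2 /=; apply/andP; split.
    by rewrite map_inj_in_uniq ?iota_uniq // => i j; rewrite !mem_iota => *; apply: dI.
  apply/(cycle_nthP adj x0); rewrite size_mkseq; first by lia.
  split=> [i ni|]; first by rewrite !nth_mkseq ?d1 //; lia.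
  by rewrite !nth_mkseq //; lia.
exists k, c; split=> // i j /andP[ij jk].
have [->|ji] := eqVneq j i.+1; first by rewrite Cs1 //; lia.
have [->|jk1] /= := eqVneq j k.-1.
  have [->|i0] /= := eqVneq i 0; first by rewrite adjC Cs2.
  apply/negP => ch; suff : k <= (k.-1 - i).+1 by lia.
  apply: (kmin _ (fun l => c (i + l))) => [||l lk|]; first by lia.
  - by move=> a b; rewrite !inE => ak bk /cI; rewrite !inE; lia.
  - by rewrite addnS; apply: Cs1; lia.
  - by rewrite addn0 adjC (_ : _ + _ = k.-1) //; lia.
rewrite andbF; apply/negP => ch; suff : k <= (j - i).+1 by lia.
apply: (kmin _ (fun l => c (i + l))) => [||l lk|]; first by lia.
- by move=> a b; rewrite !inE => ak bk /cI; rewrite !inE; lia.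
- by rewrite addnS; apply: Cs1; lia.
- by rewrite addn0 adjC (_ : _ + _ = j) //; lia.
Qed.

Local Open Scope ring_scope.

Section CycleEntries.
Variables (V : finType) (adj : rel V) (m : V -> V -> nat).
Hypotheses (gr : coxeter_graph adj m) (om : odd_labels adj m).
Variables (k : nat) (c : nat -> V).
Hypotheses (k2 : (2 < k)%N) (cI : {in gtn k &, injective c}).
Hypothesis cadj : forall i j, (i < j < k)%N ->
  adj (c i) (c j) = (j == i.+1) || (i == 0%N) && (j == k.-1).
Lemma cycle_angle_adj i : (i < k)%N -> adj (c i) (c (if i == k.-1 then 0%N else i.+1)).
Proof.
move=> ik; have [adjC _] := gr; case: ifP => [/eqP->|/eqP ik1].
  by rewrite adjC cadj ?eqxx ?orbT //; lia.
by rewrite cadj ?eqxx //; lia.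
Qed.

Variables (F : finFieldType) (z : F).
Hypothesis zP : (2 * label_prod adj m).-primitive_root z.

Definition cycle_angle i := angle adj m z (c i) (c (if i == k.-1 then 0%N else i.+1)).
Variables (pr : nat -> nat -> F).
Hypothesis pr2 : forall i, (i < k)%N -> pr i i = 2%:R.
Hypothesis prM : forall i j, (i < k)%N -> (j < k)%N -> j = i.+1 \/ (i = k.-1 /\ j = 0%N) ->
  pr i j * pr j i = 2%:R + cycle_angle i + (cycle_angle i)^-1.

Definition cycle_index v := index v (mkseq c k).
Definition cycle_entry v w :=
  if (cycle_index v < k)%N && (cycle_index w < k)%N
  then pr (cycle_index v) (cycle_index w) else std_entry adj m z v w.

Lemma cycle_indexK i : (i < k)%N -> cycle_index (c i) = i.
Proof.
move=> ik; rewrite /cycle_index -{1}(nth_mkseq (c 0) c ik) index_uniq ?size_mkseq //.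
by rewrite map_inj_in_uniq ?iota_uniq // => a b; rewrite !mem_iota => *; apply: cI.
Qed.

Lemma cycle_indexP v : (cycle_index v < k)%N -> v = c (cycle_index v).
Proof.
move=> vk; rewrite -(nth_mkseq v c vk) nth_index //.
by rewrite -index_mem size_mkseq.
Qed.

Lemma cycle_entryE i j : (i < k)%N -> (j < k)%N -> cycle_entry (c i) (c j) = pr i j.
Proof. by move=> ik jk; rewrite /cycle_entry !cycle_indexK // ik jk. Qed.

Lemma cycle_entry2 v : cycle_entry v v = 2%:R.
Proof.
rewrite /cycle_entry; case: ifP => [/andP[vk _]|_]; first exact: pr2.
exact: std_entry2.
Qed.

(** Since the cycle has no chord, the only adjacent pairs on it are consecutive ones, for which
    [prM] gives the product. The exceptional angle -1 cannot occur: with an odd label it would give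
    -1 = 1. *)
Lemma cycle_cartan : cartan adj m cycle_entry.
Proof.
split=> [|v w vw]; first exact: cycle_entry2.
exists (angle adj m z v w).
have a1 : angle adj m z v w != 1 by apply: angle_neq1.
have am : angle adj m z v w ^+ m v w = 1 by apply: angleX.
split=> // [|e]; last first.
  case/eqP: (natr2_neq0 zP); apply/eqP; rewrite -subr_eq0 subr0.
  move: am; rewrite e -signr_odd om // expr1 => /eqP; rewrite eq_sym -subr_eq0 opprK.
  by rewrite -(natrD F 1 1).
have [adjC _] := gr.
rewrite /cycle_entry andbC; case: ifP => [/andP[wk vk]|_]; last exact: std_entryM.
move: vw a1 am; rewrite (cycle_indexP vk) (cycle_indexP wk) !cycle_indexK //.
move: {v w} (cycle_index v) (cycle_index w) vk wk => i j ik jk vw _ _.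
wlog ij : i j ik jk vw / (i < j)%N.
  move=> IH; case: (ltngtP i j) => [ij|ji|e]; first exact: IH.
    by rewrite mulrC angle_sym // IH // adjC.
  by rewrite e in vw; have := coxeter_adj_neq gr vw; rewrite eqxx.
have := vw; rewrite cadj ?ij // => /orP[/eqP ej|/andP[/eqP i0 /eqP jk1]].
  rewrite ej in jk *; rewrite prM //; last by left.
  by rewrite /cycle_angle; case: eqP => // e; lia.
rewrite i0 jk1 in vw ik jk *; rewrite mulrC prM //; last by right.
by rewrite /cycle_angle eqxx angle_sym // adjC.
Qed.

End CycleEntries.

(** * Exclusion of cycles *)

Section NoCycle.
Variables (V : finType) (rt : V -> V) (mm : V -> nat).
Hypothesis rtK : forall v, rt (rt v) = rt v.
Hypothesis odd_mm : forall v, rt v != v -> odd (mm v).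
Variables (V' : finType) (adj' : rel V') (m' : V' -> V' -> nat).
Variable C : forall gT : finGroupType, (V -> gT) -> (V' -> gT) -> Prop.
Hypothesis tC : transfer (star_adj rt) (star_label rt mm) adj' m' C.
Hypotheses (gr' : coxeter_graph adj' m') (om' : odd_labels adj' m').
Variables (k : nat) (c : nat -> V').
Hypotheses (k2 : (2 < k)%N) (cI : {in gtn k &, injective c}).
Hypothesis cadj : forall i j, (i < j < k)%N ->
  adj' (c i) (c j) = (j == i.+1) || (i == 0%N) && (j == k.-1).
Variables (F : finFieldType) (z : F) (p : nat).
Hypothesis zP : (2 * label_prod adj' m').-primitive_root z.
Hypotheses (pF : p \in [pchar F]) (op : odd p).
Hypothesis pmm : forall v, rt v != v -> coprime (mm v) p.
Variables (ex ey px py : nat -> F) (y1 y2 : F * F).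
Let pr i j := px i * ex j + py i * ey j.
Let ang := cycle_angle adj' m' k c z.
Hypothesis pr2 : forall i, (i < k)%N -> pr i i = 2%:R.
Hypothesis prM : forall i j, (i < k)%N -> (j < k)%N -> j = i.+1 \/ (i = k.-1 /\ j = 0%N) ->
  pr i j * pr j i = 2%:R + ang i + (ang i)^-1.
Hypothesis indep : px 1 * py k.-1 - py 1 * px k.-1 != 0.
Hypothesis y1P : px 1 * y1.1 + py 1 * y1.2 = 0 /\ px 0 * y1.1 + py 0 * y1.2 = 1.
Hypothesis y2P : px k.-1 * y2.1 + py k.-1 * y2.2 = 0 /\ px 0 * y2.1 + py 0 * y2.2 = 1.
Hypothesis y12 : y1.1 * ey 0 - y1.2 * ex 0 != y2.1 * ey 0 - y2.2 * ex 0.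

Local Notation T := {ffun V' -> F}.
Let A := cycle_entry adj' m' k c z pr.
Let A2 : forall v, A v v = 2%:R.
Proof. exact: cycle_entry2 pr2. Qed.

(* The mirrors of the vertices of the cycle cut the affine plane in lines, all but the
   first of which go through the origin. *)
Definition frame (x : T) (y : F * F) :=
  [forall i : 'I_k, x (c i) == px i * y.1 + py i * y.2 - (i == 0%N :> nat)%:R].

(** The affine plane is a subquotient of the representation, [frame x y] meaning that [x] represents
    the point [y]; here [q] induces [b] on it. *)
Definition frame_compat (q : {perm T}) (b : {perm F * F}) :=
  [forall x, forall y, frame x y ==> frame (q x) (b y)].

Lemma frame_compatP (q : {perm T}) (b : {perm F * F}) :
  reflect (forall x y, frame x y -> frame (q x) (b y)) (frame_compat q b).
Proof.
by apply: (iffP 'forall_forallP) => H x y; [apply/implyP | apply/implyP/H].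
Qed.

Lemma frame_inj x y y' : frame x y -> frame x y' -> y = y'.
Proof.
move=> /forallP fy /forallP fy'.
have k1 : (1 < k)%N by lia.
have kk : (k.-1 < k)%N by lia.
have e i : (i < k)%N -> px i * (y.1 - y'.1) + py i * (y.2 - y'.2) = 0.
  move=> ik; have /eqP := fy (Ordinal ik); have /eqP -> := fy' (Ordinal ik).
  by move=> /addIr /= e; transitivity (px i * y.1 + py i * y.2 - (px i * y'.1 + py i * y'.2));
    [ring | rewrite e subrr].
case: y y' e {fy fy'} => a b [a' b'] /= e.
have E1 : (px 1 * py k.-1 - py 1 * px k.-1) * (a - a') = 0.
  transitivity (py k.-1 * (px 1 * (a - a') + py 1 * (b - b')) -
     py 1 * (px k.-1 * (a - a') + py k.-1 * (b - b'))); first by ring.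
  by rewrite !e // !mulr0 subrr.
have E2 : (px 1 * py k.-1 - py 1 * px k.-1) * (b - b') = 0.
  transitivity (px 1 * (px k.-1 * (a - a') + py k.-1 * (b - b')) -
    px k.-1 * (px 1 * (a - a') + py 1 * (b - b'))); first by ring.
  by rewrite !e // !mulr0 subrr.
move/eqP: E1; move/eqP: E2; rewrite !mulf_eq0 (negPf indep) !subr_eq0 /=.
by move=> /eqP-> /eqP->.
Qed.

Lemma frame_exists y : exists x, frame x y.
Proof.
exists [ffun v => let i := cycle_index k c v in px i * y.1 + py i * y.2 - (i == 0%N)%:R].
by apply/forallP=> i; rewrite ffunE (cycle_indexK cI).
Qed.

Lemma frame_compat_uniq q b b' : frame_compat q b -> frame_compat q b' -> b = b'.
Proof.
move=> /frame_compatP qb /frame_compatP qb'; apply/permP=> y.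
by have [x xy] := frame_exists y; apply: frame_inj (qb _ _ xy) (qb' _ _ xy).
Qed.

Lemma frame_compatM q b q' b' : frame_compat q b -> frame_compat q' b' ->
  frame_compat (q * q')%g (b * b')%g.
Proof.
move=> /frame_compatP qb /frame_compatP qb'; apply/frame_compatP=> x y xy.
by rewrite !permM; apply/qb'/qb.
Qed.

(** On this subgroup [frame_map] is a homomorphism to the affine group, which coinduction extends to
    the whole permutation group. *)
Definition frame_stab := [set q | [exists e : heis F, frame_compat q (heis_act e)]].

Lemma heis_act1 : heis_act (1%g : heis F) = 1%g.
Proof. by apply/permP=> y; rewrite permE perm1 heis_act_fun1. Qed.

Lemma frame_stab_group_set : group_set frame_stab.
Proof.
apply/group_setP; split.
  rewrite inE; apply/existsP; exists 1%g; rewrite heis_act1.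
  by apply/frame_compatP=> x y; rewrite !perm1.
move=> q q'; rewrite !inE => /existsP[e qe] /existsP[e' qe'].
by apply/existsP; exists (e * e')%g; rewrite heis_actM frame_compatM.
Qed.
Canonical frame_stab_group := Group frame_stab_group_set.

Definition frame_map (q : {perm T}) : {perm F * F} :=
  if [pick e : heis F | frame_compat q (heis_act e)] is Some e then heis_act e else 1%g.

Lemma frame_mapE q e : frame_compat q (heis_act e) -> frame_map q = heis_act e.
Proof.
move=> qe; rewrite /frame_map; case: pickP => [e' qe'|/(_ e)]; last by rewrite qe.
exact: frame_compat_uniq qe' qe.
Qed.

Lemma frame_mapM : {in frame_stab_group &, {morph frame_map : q r / (q * r)%g}}.
Proof.
move=> q r; rewrite !inE => /existsP[e qe] /existsP[e' re'].
rewrite (frame_mapE qe) (frame_mapE re') -heis_actM; apply: frame_mapE.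
by rewrite heis_actM frame_compatM.
Qed.

Lemma frame_map_lift q : exists e : heis F, heis_act e = frame_map q.
Proof.
by rewrite /frame_map; case: pickP => [e _|_]; [exists e | exists 1%g; rewrite heis_act1].
Qed.

(** [refl A2 (c i)] acts on the plane by y -> y - (p_i . y - [i = 0]) e_i, a reflection because p_i
    . e_i = 2; the lift takes central coordinate 0. *)
Lemma heis_reflection i : (i < k)%N -> exists e : heis F,
  [/\ (val e).1.2 = ((i == 0%N)%:R * ex i, (i == 0%N)%:R * ey i),
      (val e).2 = (1 - px i * ex i, - (px i * ey i), - (py i * ex i), 1 - py i * ey i),
      heis_det (val e) = -1 & frame_compat (refl A2 (c i)) (heis_act e)].
Proof.
move=> ik; pose r : F * (F * F) * (F * F * F * F) :=
  (0, ((i == 0%N)%:R * ex i, (i == 0%N)%:R * ey i),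
   (1 - px i * ex i, - (px i * ey i), - (py i * ex i), 1 - py i * ey i)).
have dr : heis_det r = -1.
  rewrite /r /=; transitivity (1 - pr i i); first by rewrite /pr; ring.
  by rewrite pr2 //; ring.
have r0 : heis_det r != 0 by rewrite dr oppr_eq0 oner_neq0.
exists (exist (fun x => is_true (heis_det x != 0)) r r0); split=> //.
apply/frame_compatP=> x y /forallP xy; apply/forallP=> j; apply/eqP.
rewrite reflE permE /heis_act_fun /= (eqP (xy j)) (eqP (xy (Ordinal ik))) /=.
by rewrite /A cycle_entryE // /pr; ring.
Qed.

(** The coinduced plane action is transferred to [W_Gamma], lifted there along the Heisenberg
    extension, and transferred back. At the coset of the stabiliser this gives lifts [Y i] of the
    plane reflections that obey the relations of the cycle. *)
Theorem no_chordless_cycle : False.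
Proof.
have Rrho : fin_rel adj' m' (refl A2).
  exact: (refl_fin_rel A2 gr' (cycle_cartan gr' om' k2 cI cadj zP pr2 prM)).
have [t Ct] := transfer_r tC Rrho.
have Cf := transfer_nat tC (coindM frame_mapM) Ct.
have [/(star_relP mm rtK) Rf _] := transfer_rel tC Cf.
Local Open Scope group_scope.
pose f := coind frame_stab_group frame_map \o t.
pose pi := @wreath_map (heis F) _ {set {perm T}} (@heis_act F).
have piM : {morph pi : x y / x * y} by apply: wreath_mapM (@heis_actM F).
have pi_ker x : pi x = 1 -> x ^+ p = 1 by apply: (wreath_map_ker (heis_act_ker pF)).
have f_lift v : exists2 y, y * y = 1 & pi y = f v.
  have [y py0] : exists y, pi y = f v.
    have /fin_all_exists[g gP] B : exists e : heis F, heis_act e = (f v).1 B.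
      rewrite ffunE /coind_cocycle; case: ifP => _; last by exists 1; rewrite heis_act1.
      exact: frame_map_lift.
    exists ([ffun B => g B], (f v).2); rewrite [RHS]surjective_pairing; congr pair.
    by apply/ffunP=> B; rewrite !ffunE gP ffunE.
  have f2 : f v * f v = 1 by apply: Rf.1.
  (* [y ^+ 2] lies in the kernel, of exponent [p], so [y ^+ p] squares to 1; as [p] is odd it still
     lies over [f v]. *)
  exists (y ^+ p); last first.
    rewrite (morph_exp piM) py0 -(odd_double_half p) op -muln2 mulnC expgD expgM expg1.
    by rewrite [_ ^+ 2]expgS expg1 f2 expg1n mulg1.
  by rewrite -expgMn // -[y * y]/(y ^+ 2) pi_ker // (morph_exp piM) py0 expgS expg1.
have [v rtv|u Ru pu] := lift_star piM pi_ker rtK _ Rf f_lift.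
  by split; [have := odd_mm rtv; case: (mm v) | exact: pmm].
have [u' [u2 um] pu'] := transfer_lift tC piM Cf ((star_relP mm rtK _).2 Ru) pu.
pose H : {set {perm T}} := frame_stab_group.
have inH i : (i < k)%N -> refl A2 (c i) \in frame_stab_group.
  by case/heis_reflection=> e [_ _ _ ce]; rewrite inE; apply/existsP; exists e.
have fixH i : (i < k)%N -> (u' (c i)).2 H = H.
  move=> ik; have e2 : (u' (c i)).2 = (coind frame_stab_group frame_map (refl A2 (c i))).2.
    exact: (congr1 (fun b : wreath _ _ => b.2) (pu' (c i))).
  by rewrite e2 coind_fix ?inH.
pose Y i := (u' (c i)).1 H.
have YE i : (i < k)%N -> heis_act (Y i) = frame_map (refl A2 (c i)).
  move=> ik; have := congr1 (fun b : wreath _ _ => b.1 H) (pu' (c i)).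
  by rewrite coind_val ?inH // ffunE.
have YP i : (i < k)%N ->
  [/\ (val (Y i)).1.2 = ((i == 0%N)%:R * ex i, (i == 0%N)%:R * ey i)%R,
      (val (Y i)).2 = (1 - px i * ex i, - (px i * ey i), - (py i * ex i), 1 - py i * ey i)%R &
      heis_det (val (Y i)) = (-1)%R].
  move=> ik; have [e [e1 e2 e3 ce]] := heis_reflection ik.
  have [E1 E2] : (val (Y i)).1.2 = (val e).1.2 /\ (val (Y i)).2 = (val e).2.
    by apply: heis_act_eq; rewrite YE // (frame_mapE ce).
  rewrite E1 E2; split=> //; rewrite -e3; move: E2.
  by case: (val (Y i)) (val e) => [[? ?] ?] [[? ?] ?] /= ->.
have Ym i j : (i < k)%N -> (j < k)%N -> adj' (c i) (c j) ->
    (Y i * Y j) ^+ m' (c i) (c j) = 1.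
  move=> ik jk ij; have := um _ _ ij; rewrite gpow_expg /= => e.
  have fij : (u' (c i) * u' (c j)).2 H = H by apply: wreath2_fix; apply: fixH.
  have := (wreathX_fix (m' (c i) (c j)) fij).2; rewrite e ffunE wreath1_fix ?fixH //.
(* The central coordinates of the lifts [Y i] agree for [i > 0]; the two edges at
   [c 0] would require two different values. *)
have adjC : forall v w, adj' v w = adj' w v by case: gr'.
have mF i j : adj' (c i) (c j) -> forall x : F, (x *+ m' (c i) (c j) = 0 -> x = 0)%R.
  move=> ij x /eqP; rewrite -mulr_natr mulf_eq0 => /orP[/eqP //|].
  by rewrite (negPf (prim_root_dvd_eq0 zP _)) // dvdn_mull // dvdn_label.
have Yu0 i : (0 < i < k)%N -> (val (Y i)).1.2 = (0, 0)%R.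
  by case/andP=> i0 ik; have [-> _ _] := YP i ik; rewrite gtn_eqF // !mul0r.
have Zstep i : (0 < i)%N -> (i.+1 < k)%N -> (val (Y i)).1.1 = (val (Y i.+1)).1.1.
  move=> i0 ik; have ik' := ltnW ik.
  have [_ _ di] := YP i ik'; have [_ _ di'] := YP i.+1 ik.
  have ui : (val (Y i)).1.2 = (0, 0)%R by apply: Yu0; rewrite i0.
  have ui' : (val (Y i.+1)).1.2 = (0, 0)%R by apply: Yu0.
  have [e1 e2 e3] := heis_mul_reflections ui di di'.
  have ij : adj' (c i) (c i.+1) by rewrite cadj ?eqxx ?ltnSn.
  have [] := heis_linearX (x := Y i * Y i.+1) (m' (c i) (c i.+1)) _ e3; first by rewrite e2.
  rewrite Ym // e1 => /esym/(mF _ _ ij)/eqP; rewrite subr_eq0 => /eqP-> //.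
have Zconst i : (0 < i < k)%N -> (val (Y i)).1.1 = (val (Y 1%N)).1.1.
  elim: i => // -[|i] IHi // ik; rewrite -Zstep //; apply: IHi.
  by rewrite /= ltnW.
(* The mirrors of [c 0] and [c j] meet at [y], which is fixed by [Y j * Y 0]; the relation forces
   the central coordinate seen from [y] to vanish. *)
have Zlast j y : (0 < j < k)%N -> adj' (c j) (c 0) ->
    (px j * y.1 + py j * y.2 = 0 -> px 0 * y.1 + py 0 * y.2 = 1 ->
    (val (Y 0%N)).1.1 - (val (Y j)).1.1 + (y.1 * ey 0 - y.2 * ex 0) = 0)%R.
  move=> j0k j0 yj y0; have [j0' jk] := andP j0k; have k0 : (0 < k)%N by lia.
  have [u0 M0 d0] := YP 0%N k0; have [uj Mj dj] := YP j jk.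
  have [e1 e2 e3] := heis_mul_reflections (Yu0 j j0k) dj d0.
  have yfix : heis_act_fun (Y j * Y 0%N) y = y.
    rewrite heis_act_funM /= /heis_act_fun.
    move: uj Mj u0 M0; case: (val (Y j)) => [[zj ?] ?] /= -> ->.
    case: (val (Y 0%N)) => [[z0 ?] ?] /= -> ->.
    rewrite gtn_eqF // !mul0r !addr0 !mul1r /=; case: y yj y0 => a b /= yj y0.
    have -> : (a * (1 - px j * ex j) + b * - (py j * ex j) = a - (px j * a + py j * b) * ex j)%R.
      by ring.
    have -> : (a * - (px j * ey j) + b * (1 - py j * ey j) = b - (px j * a + py j * b) * ey j)%R.
      by ring.
    rewrite yj !mul0r !subr0; congr pair.
      by transitivity (a - (px 0 * a + py 0 * b - 1) * ex 0)%R; [ring | rewrite y0; ring].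
    by transitivity (b - (px 0 * a + py 0 * b - 1) * ey 0)%R; [ring | rewrite y0; ring].
  have := heis_fixpoint_expg e3 yfix (Ym _ _ jk k0 j0); rewrite e1 e2 u0 eqxx /= !mul1r.
  exact: mF.
have k1 : (0 < 1 < k)%N by lia.
have kk : (0 < k.-1 < k)%N by lia.
have a1 : adj' (c 1) (c 0) by rewrite adjC cadj ?eqxx //; lia.
have ak : adj' (c k.-1) (c 0) by rewrite adjC cadj ?eqxx ?orbT //; lia.
have := Zlast _ _ k1 a1 y1P.1 y1P.2; have := Zlast _ _ kk ak y2P.1 y2P.2.
rewrite (Zconst _ kk) => E2 E1; case/eqP: y12.
exact: addrI (etrans E1 (esym E2)).
Qed.

End NoCycle.

Local Close Scope ring_scope.

Section TransferForest.
Variables (V : finType) (rt : V -> V) (mm : V -> nat).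
Hypothesis rtK : forall v, rt (rt v) = rt v.
Hypothesis odd_mm : forall v, rt v != v -> odd (mm v).
Variables (V' : finType) (adj' : rel V') (m' : V' -> V' -> nat).
Variable C : forall gT : finGroupType, (V -> gT) -> (V' -> gT) -> Prop.
Hypothesis tC : transfer (star_adj rt) (star_label rt mm) adj' m' C.
Hypothesis gr' : coxeter_graph adj' m'.

(** The odd prime [p] is coprime to all labels of both graphs: to those of the stars for lifting
    along a kernel of exponent [p], and to those of [adj'] for roots of unity in characteristic
    [p]. *)
Theorem transfer_forest : forest adj'.
Proof.
apply: NNPP => nf; have om' := transfer_odd_labels rtK odd_mm tC gr'.
have [adjC _] := gr'.
have [k [c [k2 cI cadj]]] := chordless_cycle adjC nf.
pose N := label_prod adj' m'; pose M := \prod_(v | rt v != v) mm v.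
have N0 : 0 < N by apply: label_prod_gt0.
have M0 : 0 < M by apply: prodn_cond_gt0 => v /odd_mm; case: (mm v).
have NM0 : 0 < N * M by rewrite muln_gt0 N0.
have [p [pp op cop]] := prime_coprime_above NM0.
have copN : coprime (2 * N) p.
  by apply: coprime_dvdl cop; rewrite mulnA dvdn_mulr.
have pmm v : rt v != v -> coprime (mm v) p.
  move=> rtv; apply: coprime_dvdl cop; rewrite dvdn_mull // dvdn_mull //.
  by rewrite /M (bigD1 v) //= dvdn_mulr.
have oN : odd N.
  rewrite /N /label_prod; elim/big_ind: _ => // [x y ox oy|[v w] /= vw]; first by rewrite oddM ox.
  exact: om'.
have N20 : 0 < 2 * N by rewrite muln_gt0.
have [F [pF [z zP] [f [fz fsq]]]] := finfield_with_sqrt pp op N20 copN.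
have F2 := natr2_neq0 zP.
have angN i : (i < k) -> (cycle_angle adj' m' k c z i ^+ N = 1)%R.
  move=> ik; have ai := cycle_angle_adj gr' k2 cadj ik.
  have /dvdnP[j ->] : m' (c i) (c (if i == k.-1 then 0 else i.+1)) %| N by apply: dvdn_label.
  by rewrite mulnC exprM angleX // expr1n.
have ang1 i : (i < k) -> (cycle_angle adj' m' k c z i != 1)%R.
  by move=> ik; have := angle_neq1 gr' zP (cycle_angle_adj gr' k2 cadj ik).
have fN x : (x ^+ N = 1 -> f x = x)%R.
  by move=> xN; apply: fz; rewrite mulnC exprM xN expr1n.
have [ex [ey [px [py [pr2 prM indep [y1 [y2 [a b a' b' y12]]]]]]]] :=
  plane_reflections k2 oN angN ang1 fN fsq F2.
exact: (no_chordless_cycle rtK odd_mm tC gr' om' k2 cI cadj zP pF op pmm pr2 prM indep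
  (conj a b) (conj a' b') y12).
Qed.

End TransferForest.

(** * Presentations of forests by stars *)

Section RootedForest.
Variables (V : finType) (adj : rel V).
Hypotheses (adjC : forall v w, adj v w = adj w v) (adj_irr : forall v, ~~ adj v v).
Hypothesis fo : forest adj.

Definition parent_edge (rt par : V -> V) : rel V :=
  fun v w => (rt v != v) && (par v == w) || (rt w != w) && (par w == v).

(** [rt] picks a representative of each component, [rank] is the distance to it, and the parent is
    the next vertex on a shortest path. *)
Lemma rooted_forest : exists (rt par : V -> V) (rank : V -> nat),
  [/\ forall v, rt (rt v) = rt v,
      forall v, rt v != v -> [/\ adj v (par v), rank (par v) < rank v & rt (par v) = rt v] &
      forall v w, adj v w -> parent_edge rt par v w].
Proof.
have cs : connect_sym adj by apply: sym_connect_sym; apply: adjC.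
pose rt := fingraph.root adj.
have dP v : exists n, [exists p : n.-tuple V, path adj v p && (last v p == rt v)].
  have /connectP[p pp ep] := connect_root adj v.
  by exists (size p); apply/existsP; exists (in_tuple p); rewrite /= pp -ep eqxx.
pose rank v := ex_minn (dP v).
have rank_le v p : path adj v p -> last v p = rt v -> rank v <= size p.
  move=> pp lp; rewrite /rank; case: ex_minnP => n _; apply.
  by apply/existsP; exists (in_tuple p); rewrite /= pp lp eqxx.
have rt_adj v w : adj v w -> rt v = rt w.
  by move=> vw; apply/eqP; rewrite /rt root_connect // connect1.
have /fin_all_exists[par parP] v : exists w, rt v != v -> adj v w /\ rank w < rank v.
  case: (eqVneq (rt v) v) => [_|rv]; first by exists v.
  have := erefl (rank v); rewrite {2}/rank; case: ex_minnP => n /existsP[p /andP[pp /eqP lp]] _ rn.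
  have sp := size_tuple p; case: p sp pp lp => -[|w p] /= _ sp; first by move=> _ e; rewrite -e eqxx in rv.
  case/andP=> vw pp lp; exists w => _; split=> //.
  by rewrite rn -sp ltnS rank_le // lp (rt_adj v w).
exists rt, par, rank; split=> [v|v rv|v w vw].
- by rewrite /rt root_root.
- by have [vp rp] := parP v rv; rewrite (rt_adj v (par v)).
(* Any further edge would close a cycle with a tree path. *)
apply/negPn/negP => nvw; pose T := parent_edge rt par.
have TC : symmetric T by move=> x y; rewrite /T /parent_edge orbC.
have csT : connect_sym T by apply: sym_connect_sym.
have T_rt x : connect T x (rt x).
  have [n] := ubnP (rank x); elim: n x => // n IHn x rx.
  have [->|rtx] := eqVneq (rt x) x; first exact: connect0.
  have [xp rp] := parP x rtx.
  apply: (connect_trans (y := par x)); first by apply: connect1; rewrite /T /parent_edge rtx eqxx.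
  by rewrite (rt_adj _ _ xp); apply: IHn; rewrite (leq_trans rp).
have T_adj x y : T x y -> adj x y.
  by case/orP=> /andP[/parP[a _] /eqP <-] //; rewrite adjC.
have : connect T v w.
  by apply: connect_trans (T_rt v) _; rewrite csT (rt_adj v w).
case/connectP=> p0 p0P ep0; move: ep0; case/shortenP: p0P => p pp Up _ lp.
have p1 : 1 < size p.
  case: p pp Up lp => [_ _ e|x [|y p]] //=; first by move: vw; rewrite e /= (negPf (adj_irr v)).
  by rewrite andbT => vx _ /= e; move: nvw; rewrite e -/(T v x) vx.
have /negP := fo Up (p1 : 3 <= size (v :: p)); apply.
rewrite /= rcons_path -lp adjC vw andbT.
by apply: sub_path pp.
Qed.

End RootedForest.

Section ParentRecursion.
Variables (V : finType) (rt par : V -> V) (rank : V -> nat).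
Hypothesis par_rank : forall v, rt v != v -> rank (par v) < rank v.

Lemma parent_recursion (X : Type) (b : V -> X) (st : V -> X -> X) :
  exists f : V -> X, forall v, f v = if rt v == v then b v else st v (f (par v)).
Proof.
pose F := fix F n v := if n is n'.+1 then if rt v == v then b v else st v (F n' (par v)) else b v.
have FE n n' v : rank v < n -> rank v < n' -> F n v = F n' v.
  elim: n n' v => // n IHn [|n'] v //= rn rn'; case: eqVneq => // rv.
  by congr st; apply: IHn; apply: leq_trans (par_rank rv) _.
exists (fun v => F (rank v).+1 v) => v /=; case: eqVneq => // rv.
congr (st v _); rewrite -[RHS]/(F (rank (par v)).+1 (par v)).
by apply: FE; rewrite ?ltnS // par_rank.
Qed.

Lemma parent_ind (P : V -> Prop) :
  (forall v, rt v = v -> P v) -> (forall v, rt v != v -> P (par v) -> P v) -> forall v, P v.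
Proof.
move=> Pr Pp v; have [n] := ubnP (rank v); elim: n v => // n IHn v rv.
have [/Pr //|rtv] := eqVneq (rt v) v.
by apply: Pp => //; apply: IHn; apply: leq_trans (par_rank rtv) _.
Qed.

End ParentRecursion.

(* Conjugates [y] to [x] when [x] and [y] generate a dihedral group of order [2n], [n] odd. *)
Definition dihedral_conj (H : Grp) (x y : H) (n : nat) := gpow (gmul x y) (uphalf n).

Section DihedralConj.
Variable H : Grp.
Implicit Types x y g : H.

Lemma gpowSr x n : gpow x n.+1 = gmul (gpow x n) x.
Proof. by elim: n => [|n IHn] /=; rewrite ?gmulg1 ?gmul1g // -gmulA -IHn. Qed.

Lemma gpowD x n p : gpow x (n + p) = gmul (gpow x n) (gpow x p).
Proof. by elim: n => [|n IHn] /=; rewrite ?gmul1g // IHn gmulA. Qed.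

Lemma gpow_conj g x n :
  gpow (gmul (ginv g) (gmul x g)) n = gmul (ginv g) (gmul (gpow x n) g).
Proof.
elim: n => [|n IHn] /=; first by rewrite gmul1g gmulVg.
by rewrite IHn -!gmulA gmulKV.
Qed.

(** With r = x y and n = 2 j + 1, r^(j+1) = r^(-j) and r^j x r^j = x, so r^(j+1) y = r^j x = x
    r^(-j). *)
Lemma dihedral_conjP x y n : odd n -> gmul x x = gone -> gmul y y = gone ->
  gpow (gmul x y) n = gone -> gmul (dihedral_conj x y n) y = gmul x (dihedral_conj x y n).
Proof.
move=> on x2 y2 xyn; pose r := gmul x y; pose j := n./2.
have rj : gpow r j.+1 = ginv (gpow r j).
  apply/esym/ginv_eq; rewrite -gpowD addnS addnn -[RHS]xyn; congr gpow.
  by rewrite -[in RHS](odd_double_half n) on.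
have -> : dihedral_conj x y n = gpow r j.+1.
  by rewrite /dihedral_conj uphalf_half on.
have rxr : gmul r (gmul x r) = x by rewrite /r -!gmulA [gmul x (gmul x y)]gmulA x2 gmul1g y2 gmulg1.
have flip i : gmul (gpow r i) (gmul x (gpow r i)) = x.
  elim: i => [|i IHi]; first by rewrite gmul1g gmulg1.
  rewrite {1}gpowSr /= -gmulA [gmul x (gmul r _)]gmulA [gmul r (gmul (gmul x r) _)]gmulA.
  by rewrite rxr IHi.
have ry : gmul r y = x by rewrite /r -gmulA y2 gmulg1.
by rewrite {1}gpowSr -gmulA ry rj -{2}(flip j) -!gmulA gmulgV gmulg1.
Qed.

End DihedralConj.

Section StarPresentation.
Variables (V : finType) (adj : rel V) (m : V -> V -> nat) (G : Grp) (s : V -> G).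
Hypotheses (gr : coxeter_graph adj m) (om : odd_labels adj m).
Hypothesis Ps : coxeter_presentation adj m s.
Variables (rt par : V -> V) (rank : V -> nat).
Hypothesis rtK : forall v, rt (rt v) = rt v.
Hypothesis parP : forall v, rt v != v ->
  [/\ adj v (par v), rank (par v) < rank v & rt (par v) = rt v].
Hypothesis par_edge : forall v w, adj v w -> parent_edge rt par v w.

Definition parent_label v := m v (par v).

Let par_rank v : rt v != v -> rank (par v) < rank v.
Proof. by case/parP. Qed.

Let adjC v w : adj v w = adj w v. Proof. by case: gr. Qed.

Lemma odd_parent_label v : rt v != v -> odd (parent_label v).
Proof. by case/parP=> /om. Qed.

(* [h v] conjugates the generator of [v] to the one of its root. *)
Definition transporter (H : Grp) (t h : V -> H) := forall v, h v =
  if rt v == v then gone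
  else gmul (h (par v)) (dihedral_conj (t (par v)) (t v) (parent_label v)).

(** Induction from the root. The relation on an edge is assumed only once the parent is known to be
    conjugate to the root, the form in which [forest_relations_of_star] can supply it. *)
Lemma transporterP (H : Grp) (t h : V -> H) : transporter t h ->
  (forall v, gmul (t v) (t v) = gone) ->
  (forall v, rt v != v -> gmul (h (par v)) (t (par v)) = gmul (t (rt v)) (h (par v)) ->
     gpow (gmul (t (par v)) (t v)) (parent_label v) = gone) ->
  forall v, gmul (h v) (t v) = gmul (t (rt v)) (h v).
Proof.
move=> hE t2 tm; apply: (parent_ind par_rank) => v rv; rewrite (hE v).
  by rewrite rv eqxx gmul1g gmulg1.
move=> IHv; have [_ _ rp] := parP rv; rewrite (negPf rv) -gmulA.
rewrite dihedral_conjP ?odd_parent_label // ?tm // -?rp //.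
by rewrite gmulA IHv rp -gmulA.
Qed.

(** The generator of [v] is conjugated by the transporter of its parent, not its own: this moves the
    edge from the parent to [v] onto an edge from the root, with the same label. *)
Lemma star_relations_of_forest (t h : V -> G) : transporter t h ->
  coxeter_relations adj m t ->
  star_rel rt parent_label
    (fun v => if rt v == v then t v else gmul (h (par v)) (gmul (t v) (ginv (h (par v))))).
Proof.
move=> hE [t2 tm].
have tp v : rt v != v -> gpow (gmul (t (par v)) (t v)) (parent_label v) = gone.
  move=> rv; have [vp _ _] := parP rv; rewrite /parent_label.
  by have [_ [_ [mS _]]] := gr; rewrite mS // tm // adjC.
have hP := transporterP hE t2 (fun v rv _ => tp v rv).
split=> [v|v rv].
  case: ifP => _; first exact: t2.
  by rewrite -!gmulA gmulVK [gmul (t v) (gmul (t v) _)]gmulA t2 gmul1g gmulgV.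
have [_ _ rp] := parP rv; rewrite rtK eqxx (negPf rv).
set g := h (par v).
have -> : t (rt v) = gmul g (gmul (t (par v)) (ginv g)).
  by rewrite gmulA /g hP rp -gmulA gmulgV gmulg1.
have -> : gmul (gmul g (gmul (t (par v)) (ginv g))) (gmul g (gmul (t v) (ginv g))) =
    gmul (ginv (ginv g)) (gmul (gmul (t (par v)) (t v)) (ginv g)).
  by rewrite ginvK -!gmulA gmulVK.
by rewrite gpow_conj tp // gmul1g gmulVg.
Qed.

Lemma forest_relations_of_star (H : Grp) (t : V -> H) : star_rel rt parent_label t ->
  exists t' h' : V -> H, [/\ transporter t' h', coxeter_relations adj m t' &
    forall v, t' v = if rt v == v then t v else gmul (ginv (h' (par v))) (gmul (t v) (h' (par v)))].
Proof.
case=> t2 tm.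
pose st v (x : H * H) := let y := gmul (ginv x.2) (gmul (t v) x.2) in
  (y, gmul x.2 (dihedral_conj x.1 y (parent_label v))).
have [f fE] := parent_recursion par_rank (fun v => (t v, gone)) st.
pose t' v := (f v).1; pose h' v := (f v).2.
have t'E v : t' v = if rt v == v then t v else gmul (ginv (h' (par v))) (gmul (t v) (h' (par v))).
  by rewrite /t' fE; case: ifP.
have h'E : transporter t' h'.
  by move=> v; rewrite /h' /t' fE; case: eqP => //= rv; rewrite -/(t' v) [f v]fE; case: eqP.
have t'2 v : gmul (t' v) (t' v) = gone.
  rewrite t'E; case: ifP => // _.
  by rewrite -!gmulA gmulKV [gmul (t v) (gmul (t v) _)]gmulA t2 gmul1g gmulVg.
have rt_t' v : t' (rt v) = t (rt v) by rewrite t'E rtK eqxx.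
have t'm v : rt v != v -> gmul (h' (par v)) (t' (par v)) = gmul (t' (rt v)) (h' (par v)) ->
     gpow (gmul (t' (par v)) (t' v)) (parent_label v) = gone.
  move=> rv e; rewrite [t' v]t'E (negPf rv); set g := h' (par v) in e *.
  have -> : t' (par v) = gmul (ginv g) (gmul (t (rt v)) g).
    by rewrite -rt_t' -e gmulVK.
  have -> : gmul (gmul (ginv g) (gmul (t (rt v)) g)) (gmul (ginv g) (gmul (t v) g)) =
     gmul (ginv g) (gmul (gmul (t (rt v)) (t v)) g) by rewrite -!gmulA gmulKV.
  by rewrite gpow_conj tm // gmul1g gmulVg.
have h'P := transporterP h'E t'2 t'm.
have t'p v : rt v != v -> gpow (gmul (t' (par v)) (t' v)) (parent_label v) = gone.
  by move=> rv; apply: t'm => //; rewrite h'P; have [_ _ ->] := parP rv.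
exists t', h'; split=> //; split=> // v w vw.
case/orP: (par_edge vw) => /andP[rv /eqP e]; last by rewrite -e in vw *; have [_ [_ [mS _]]] := gr; rewrite mS // t'p.
by rewrite -e; apply: gpow_swap => //; apply: t'p.
Qed.

Definition generated_by (u : V -> G) (x : G) :=
  exists l : seq V, x = foldr (fun v acc => gmul (u v) acc) gone l.

Lemma generated_by1 u : generated_by u gone. Proof. by exists [::]. Qed.
Lemma generated_by_gen u v : generated_by u (u v).
Proof. by exists [:: v]; rewrite /= gmulg1. Qed.
Lemma generated_byM u x y : generated_by u x -> generated_by u y -> generated_by u (gmul x y).
Proof.
move=> [l ->] [l' ->]; exists (l ++ l'); elim: l => [|v l IHl] /=; first by rewrite gmul1g.
by rewrite -IHl gmulA.
Qed.
Lemma generated_byV u x : (forall v, gmul (u v) (u v) = gone) ->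
  generated_by u x -> generated_by u (ginv x).
Proof.
move=> u2 [l ->]; elim: l => [|v l IHl] /=.
  by rewrite (ginv_eq (gmul1g _)); apply: generated_by1.
rewrite ginvM (ginv_eq (u2 v)); apply: generated_byM IHl _; exact: generated_by_gen.
Qed.
Lemma generated_by_pow u x n : generated_by u x -> generated_by u (gpow x n).
Proof.
by move=> ux; elim: n => [|n IHn] /=; [apply: generated_by1 | apply: generated_byM].
Qed.

(** A Tietze transformation. Both [f \o h] and [h'] obey the same recursion, so the homomorphism
    given by the forest presentation sends each [u v] to the prescribed element. *)
Lemma star_presentation : exists u : V -> G,
  coxeter_presentation (star_adj rt) (star_label rt parent_label) u.
Proof.
have [h hE] := parent_recursion par_rank (fun=> gone)
  (fun v x => gmul x (dihedral_conj (s (par v)) (s v) (parent_label v))).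
have [Rs [gen_s univ_s]] := Ps.
pose u v := if rt v == v then s v else gmul (h (par v)) (gmul (s v) (ginv (h (par v)))).
have Ru : star_rel rt parent_label u by apply: star_relations_of_forest hE Rs.
exists u; split; first exact/star_relP.
split=> [x|H t /star_relP-/(_ rtK) Rt].
  suff gen_su v : generated_by u (s v) /\ generated_by u (h v).
    have [l ->] := gen_s x; elim: l => [|v l IHl] /=; first exact: generated_by1.
    by apply: generated_byM IHl; case: (gen_su v).
  elim/(parent_ind par_rank): v => v rv.
    have gv : generated_by u (s v) by have := generated_by_gen u v; rewrite /u rv eqxx.
    by split=> //; rewrite hE rv eqxx; apply: generated_by1.
  move=> [sp hp].
  have sv : generated_by u (s v).
    have -> : s v = gmul (ginv (h (par v))) (gmul (u v) (h (par v))).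
      by rewrite /u (negPf rv) -!gmulA gmulVg gmulg1 gmulVK.
    apply: generated_byM; first by apply: generated_byV Ru.1 hp.
    by apply: generated_byM hp; apply: generated_by_gen.
  split=> //; rewrite hE (negPf rv); apply: generated_byM hp _.
  by apply: generated_by_pow; apply: generated_byM.
have [t' [h' [h'E Rt' t'E]]] := forest_relations_of_star Rt.
have [f [fM fs]] := univ_s H t' Rt'.
have fh : forall v, f (h v) = h' v.
  apply: (parent_ind par_rank) => v rv; rewrite (hE v) (h'E v); first by rewrite rv eqxx hom1.
  by move=> IHv; rewrite (negPf rv) fM IHv /dihedral_conj hom_pow // fM !fs.
exists f; split=> // v; rewrite /u; have := t'E v; case: ifP => _ e; first by rewrite fs e.
by rewrite !fM homV // fh fs e -!gmulA gmulgV gmulg1 gmulKV.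
Qed.

End StarPresentation.

Theorem star_presentation_of_forest (V : finType) (adj : rel V) (m : V -> V -> nat) (G : Grp) :
  coxeter_graph adj m -> forest adj -> odd_labels adj m -> is_W adj m G ->
  exists (rt : V -> V) (mm : V -> nat),
    [/\ forall v, rt (rt v) = rt v, forall v, rt v != v -> odd (mm v) /\ 1 < mm v &
        is_W (star_adj rt) (star_label rt mm) G].
Proof.
move=> gr fo om [s Ps]; have [adjC [adj_irr [mS m2]]] := gr.
have [rt [par [rank [rtK parP par_edge]]]] := rooted_forest adjC adj_irr fo.
have [u Pu] := star_presentation gr om Ps rtK parP par_edge.
exists rt, (parent_label m par); split=> [//|v rv|]; last by exists u.
by have [vp _ _] := parP v rv; rewrite /parent_label om ?m2.
Qed.

Local Open Scope ring_scope.

(** * Counting homomorphisms to affine dihedral groups *)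

(** The group L^2 : (mu_N : 2) with N = n + 1, the shift making the exponent positive. *)
Definition affdih (L : finFieldType) (n : nat) :=
  {x : bool * L * (L * L) | x.1.2 ^+ n.+1 == 1}.
HB.instance Definition _ (L : finFieldType) n := Finite.on (affdih L n).

(* [(b, a, (x, y))] stands for the map [(p, q) |-> (a p' + x, a^-1 q' + y)] of [L^2],
   where [(p', q')] is [(q, p)] if [b] holds and [(p, q)] otherwise. *)
Section AffineDihedral.
Variables (L : finFieldType) (n : nat).
Local Notation raw := (bool * L * (L * L))%type.

Definition affdih_mul_raw (s t : raw) : raw :=
  let: (b, a, (x, y)) := s in let: (b', a', (x', y')) := t in
  (b (+) b', a * (if b then a'^-1 else a'),
   (a * (if b then y' else x') + x, a^-1 * (if b then x' else y') + y)).

Definition affdih_inv_raw (s : raw) : raw :=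
  let: (b, a, (x, y)) := s in
  if b then (b, a, (- a * y, - x / a)) else (b, a^-1, (- x / a, - a * y)).

Lemma root_neq0 (a : L) : a ^+ n.+1 == 1 -> a != 0.
Proof. by apply: contraTneq => ->; rewrite expr0n eq_sym oner_neq0. Qed.

Lemma affdih_mul_subproof (s t : affdih L n) :
  (affdih_mul_raw (val s) (val t)).1.2 ^+ n.+1 == 1.
Proof.
case: s t => -[[b a] [x y]] /= /eqP an [[[b' a'] [x' y']]] /= /eqP an'.
by rewrite exprMn an; case: b; rewrite ?exprVn an' ?invr1 mulr1.
Qed.

Lemma affdih_one_subproof : ((false, 1, (0, 0)) : raw).1.2 ^+ n.+1 == 1.
Proof. by rewrite expr1n. Qed.

Lemma affdih_inv_subproof (s : affdih L n) : (affdih_inv_raw (val s)).1.2 ^+ n.+1 == 1.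
Proof. by case: s => -[[[] a] [x y]] /= an //; rewrite exprVn (eqP an) invr1. Qed.

Definition affdih_mul (s t : affdih L n) : affdih L n :=
  exist (fun x : raw => is_true (x.1.2 ^+ n.+1 == 1)) _ (affdih_mul_subproof s t).
Definition affdih_one : affdih L n :=
  exist (fun x : raw => is_true (x.1.2 ^+ n.+1 == 1)) _ affdih_one_subproof.
Definition affdih_inv (s : affdih L n) : affdih L n :=
  exist (fun x : raw => is_true (x.1.2 ^+ n.+1 == 1)) _ (affdih_inv_subproof s).

Lemma affdih_mulA : associative affdih_mul.
Proof.
case=> -[[b a] [x y]] + [] -[[b' a'] [x' y']] + [] -[[b2 a2] [x2 y2]] + => /=.
move=> an an' an2; apply: val_inj => /=.
have := root_neq0 an; have := root_neq0 an'; have := root_neq0 an2 => /= A2 A' A.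
case: b {an}; case: b' {an'}; case: b2 {an2} => /=; congr (_, _, (_, _)); field; rewrite ?A ?A' ?A2 //.
Qed.

Lemma affdih_mul1 : left_id affdih_one affdih_mul.
Proof.
case=> -[[b a] [x y]] an; apply: val_inj => /=.
by rewrite !mul1r invr1 !mul1r !addr0.
Qed.

Lemma affdih_mulV : left_inverse affdih_one affdih_inv affdih_mul.
Proof.
case=> -[[b a] [x y]] an; apply: val_inj => /=; have /= A := root_neq0 an.
by case: b {an} => /=; congr (_, _, (_, _)); rewrite ?invrK; field.
Qed.

HB.instance Definition _ := Finite_isGroup.Build (affdih L n)
  affdih_mulA affdih_mul1 affdih_mulV.

Lemma val_affdihM (s t : affdih L n) : val (s * t)%g = affdih_mul_raw (val s) (val t).
Proof. by []. Qed.

Lemma val_affdih1 : val (1%g : affdih L n) = (false, 1, (0, 0)).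
Proof. by []. Qed.

Definition affdih_sign (s : affdih L n) : 'Z_2 := if (val s).1.1 then sgn1 else 1%g.

Lemma affdih_signM : {morph affdih_sign : s t / (s * t)%g}.
Proof.
move=> s t; rewrite /affdih_sign val_affdihM.
by case: (val s) (val t) => [[[] a] [x y]] [[[] a'] [x' y']] /=; apply: val_inj.
Qed.

Definition geom (c : L) (k : nat) := \sum_(i < k) c ^+ i.

Lemma geomS c k : geom c k.+1 = c ^+ k + geom c k.
Proof. by rewrite /geom big_ord_recr addrC. Qed.

Lemma geom_root c k : c != 1 -> c ^+ k = 1 -> geom c k = 0.
Proof.
move=> c1 ck; have := subrX1 c k; rewrite ck subrr => /esym/eqP.
by rewrite mulf_eq0 subr_eq0 (negPf c1) => /eqP.
Qed.

Lemma geom1 k : geom 1 k = k%:R.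
Proof. by rewrite /geom (eq_bigr (fun=> 1)) ?sumr_const ?card_ord // => i _; rewrite expr1n. Qed.

Lemma val_affdihX (s : affdih L n) c x y k : val s = (false, c, (x, y)) ->
  val (s ^+ k)%g = (false, c ^+ k, (geom c k * x, geom c^-1 k * y)).
Proof.
move=> sE; elim: k => [|k IHk].
  by rewrite val_affdih1 expr0 /geom !big_ord0 !mul0r.
rewrite expgSr val_affdihM IHk sE /= -exprSr !geomS exprVn.
by congr (_, _, (_, _)); ring.
Qed.

(* Junk value [1] unless [u.1] is a root of unity of the right order. *)
Definition affdih_refl (u : L * L) : affdih L n :=
  insubd (1%g : affdih L n) (true, u.1, (- u.1 * u.2, u.2)).

Lemma val_affdih_refl u : u.1 ^+ n.+1 = 1 ->
  val (affdih_refl u) = (true, u.1, (- u.1 * u.2, u.2)).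
Proof. by move=> un; rewrite val_insubd /= un eqxx. Qed.

Hypothesis L2 : 2%:R != 0 :> L.
Hypothesis on : odd n.+1.

(** When the swap [b] is absent, [a] squares to 1 among roots of odd order, hence is 1, and [L2]
    excludes translations of order 2. When it is present, one translation coordinate determines the
    other. *)
Lemma affdih_involution (s : affdih L n) : (s * s = 1)%g ->
  s = if (val s).1.1 then affdih_refl ((val s).1.2, (val s).2.2) else 1%g.
Proof.
case: s => -[[b a] [x y]] an /(congr1 val); rewrite val_affdihM val_affdih1 /=.
have /= A := root_neq0 an; case: b an => an /= [e1 e2 e3]; apply: val_inj.
  rewrite val_affdih_refl /=; last exact/eqP.
  by rewrite mulNr; congr (_, _, (_, _)); apply/eqP; rewrite -addr_eq0 addrC e2.
rewrite val_affdih1 /=; have a1 : a = 1 by apply: odd_root_sq on (eqP an) e1.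
have F x' : x' + x' = 0 :> L -> x' = 0.
  by move/eqP; rewrite -mulr2n -mulr_natr mulf_eq0 (negPf L2) orbF => /eqP.
move: e2 e3; rewrite a1 invr1 !mul1r => /F-> /F->.
by [].
Qed.

Lemma affdih_refl2 u : u.1 ^+ n.+1 = 1 -> (affdih_refl u * affdih_refl u = 1)%g.
Proof.
move=> un; have /eqP/root_neq0 u0 := un.
apply: val_inj; rewrite val_affdihM val_affdih_refl // val_affdih1 /=.
by congr (_, _, (_, _)); field.
Qed.

(** If the quotient c of the rotation parts differs from 1, the translation part of the power is a
    geometric sum that vanishes once c ^ k = 1. If c = 1 the product is a translation, and [k] is
    invertible in [L]. *)
Lemma affdih_reflM u w k : k%:R != 0 :> L -> u.1 ^+ n.+1 = 1 -> w.1 ^+ n.+1 = 1 ->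
  ((affdih_refl u * affdih_refl w) ^+ k == 1)%g =
  ((u.1 / w.1) ^+ k == 1) && ((u.1 / w.1 == 1) ==> (u.2 == w.2)).
Proof.
move=> k0 un wn; have /eqP/root_neq0 u0 := un; have /eqP/root_neq0 w0 := wn.
case: u w un wn u0 w0 => a y [b w] /= un wn a0 b0.
have E : val (affdih_refl (a, y) * affdih_refl (b, w))%g =
    (false, a / b, (a * w - a * y, y - (a / b)^-1 * w)).
  rewrite val_affdihM !val_affdih_refl //=; congr (_, _, (_, _)); first by ring.
  by field; apply/andP.
rewrite -val_eqE (val_affdihX _ E) val_affdih1 !xpair_eqE /=.
case: eqP => //= ck; case: (eqVneq (a / b)) => [c1|c1] /=; last first.
  rewrite !geom_root ?mul0r ?eqxx //; first by rewrite invr_eq1.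
  by rewrite exprVn ck invr1.
rewrite c1 invr1 geom1 mul1r !mulf_eq0 (negPf k0) /= -mulrBr mulf_eq0 (negPf a0) /=.
by rewrite !subr_eq0 [w == y]eq_sym andbb.
Qed.

End AffineDihedral.

Section CountRoots.
Variables (L : finFieldType) (N : nat) (z : L).
Hypothesis zP : N.-primitive_root z.

Lemma card_unity_roots k : (k %| N)%N -> #|[set c : L | c ^+ k == 1]| = k.
Proof.
move=> kN; have kP := dvdn_prim_root zP kN; set g := z ^+ _ in kP.
have gI : injective (fun i : 'I_k => g ^+ i).
  move=> i j /eqP; rewrite (eq_prim_root_expr kP) !modn_small // => /eqP.
  exact: val_inj.
rewrite -[RHS]card_ord -(card_imset predT gI); apply: eq_card => c; rewrite inE.
apply/eqP/imsetP => [ck|[i _ ->]]; last by rewrite exprAC (prim_expr_order kP) expr1n.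
by have [i ->] := prim_rootP kP ck; exists i.
Qed.

Lemma card_leaf_choices k : (k %| N)%N ->
  #|[set u : L * L | (u.1 ^+ k == 1) && ((u.1 == 1) ==> (u.2 == 0))]| = (1 + k.-1 * #|L|)%N.
Proof.
move=> kN; rewrite (cardsD1 (1, 0)) inE /= expr1n !eqxx; congr addn.
have := card_unity_roots kN; rewrite (cardsD1 1) inE expr1n eqxx add1n => e.
rewrite -[X in _ = (X.-1 * _)%N]e /=.
rewrite -cardsT -cardsX; apply: eq_card => -[c y]; rewrite !inE /= andbT xpair_eqE.
by case: (eqVneq c 1) => [->|c1] /=; rewrite ?expr1n ?eqxx ?andbT ?andNb.
Qed.

End CountRoots.

Section CountTuples.
Variables (V : finType) (rt : V -> V) (mm : V -> nat).
Hypothesis rtK : forall v, rt (rt v) = rt v.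
Variables (L : finFieldType) (n : nat) (z : L).
Hypothesis zP : n.+1.-primitive_root z.
Hypotheses (L2 : 2%:R != 0 :> L) (on : odd n.+1).
Hypothesis mmn : forall v, rt v != v -> (mm v %| n.+1)%N.

Definition star_relb (gT : finGroupType) (t : V -> gT) :=
  [forall v, (t v * t v == 1)%g] &&
  [forall v, (rt v != v) ==> ((t (rt v) * t v) ^+ mm v == 1)%g].

Lemma star_relbP (gT : finGroupType) (t : V -> gT) :
  reflect (star_rel rt mm (t : V -> grp_of gT)) (star_relb t).
Proof.
apply: (iffP andP) => [[/forallP t2 /forallP tm]|[t2 tm]]; split.
- by move=> v; apply/eqP/t2.
- by move=> v rv; rewrite gpow_expg; apply/eqP; apply: (implyP (tm v)).
- by apply/forallP=> v; apply/eqP/t2.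
- by apply/forallP=> v; apply/implyP=> rv; apply/eqP; have := tm v rv; rewrite gpow_expg.
Qed.

Variable chi : V -> bool.
Hypothesis chi_rt : forall v, chi (rt v) = chi v.

Definition tuples_over : {set {ffun V -> affdih L n}} :=
  [set t : {ffun V -> affdih L n} | star_relb (fun v => t v) & [forall v, (val (t v)).1.1 == chi v]].

(** Coordinates that decouple the relations: a centre chooses any reflection, a leaf records the
    quotient and the difference relative to its centre. Vertices with [chi v] false have the single
    dummy value (1, 0). *)
Definition choices (v : V) : {set L * L} :=
  if chi v then
    if rt v == v then [set u | u.1 ^+ n.+1 == 1]
    else [set u | (u.1 ^+ mm v == 1) && ((u.1 == 1) ==> (u.2 == 0))]
  else [set (1, 0)].

Definition tuple_of (d : {ffun V -> L * L}) : {ffun V -> affdih L n} := [ffun v =>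
  if chi v then affdih_refl n (if rt v == v then d v
    else ((d (rt v)).1 / (d v).1, (d (rt v)).2 + (d v).2)) else 1%g].

Definition choices_family := [set d : {ffun V -> L * L} | [forall v, d v \in choices v]].

Lemma choices_root d v : d \in choices_family -> (d v).1 ^+ n.+1 = 1.
Proof.
rewrite inE => /forallP/(_ v); rewrite /choices.
case: ifP => _; last by rewrite inE => /eqP->; rewrite expr1n.
case: (eqVneq (rt v) v) => [_|rv]; rewrite inE; first by move/eqP.
by case/andP=> /eqP dm _; case/dvdnP: (mmn rv) => j ->; rewrite mulnC exprM dm expr1n.
Qed.

Lemma tuple_of_inj : {in choices_family &, injective tuple_of}.
Proof.
move=> d d' dP d'P /ffunP e; apply/ffunP => v.
have chi0 w : ~~ chi w -> d w = d' w.
  move=> cw; have := dP; have := d'P; rewrite !inE => /forallP/(_ w) + /forallP/(_ w).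
  by rewrite /choices (negPf cw) !inE => /eqP-> /eqP->.
have root_eq w : rt w = w -> d w = d' w.
  move=> rw; case: (boolP (chi w)) => [cw|]; last exact: chi0.
  have := congr1 val (e w); rewrite !ffunE cw rw eqxx !val_affdih_refl ?choices_root //.
  by case: (d w) (d' w) => [a y] [a' y'] [-> _ ->].
have [cv|cv] := boolP (chi v); last exact: chi0.
have [rv|rv] := eqVneq (rt v) v; first exact: root_eq.
have := congr1 val (e v); rewrite !ffunE cv (negPf rv) (root_eq (rt v)) ?rtK //.
have nz u : u \in choices_family -> forall w, (u w).1 != 0.
  by move=> uP w; have /eqP/root_neq0 := choices_root w uP.
have dq u : u \in choices_family -> ((d' (rt v)).1 / (u v).1) ^+ n.+1 = 1.
  by move=> uP; rewrite expr_div_n !choices_root ?divr1.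
rewrite !val_affdih_refl ?dq //= => -[e1 _ /addrI e2].
have {}e1 : (d v).1 = (d' v).1.
  by move/(congr1 (fun x => ((d' (rt v)).1)^-1 * x)): e1; rewrite !mulKf ?nz // => /invr_inj.
by rewrite [d v]surjective_pairing e1 e2 -surjective_pairing.
Qed.

Lemma mm_neq0 v : rt v != v -> (mm v)%:R != 0 :> L.
Proof. by move=> rv; apply: (prim_root_dvd_eq0 zP); apply: mmn. Qed.

Lemma tuple_of_image : tuples_over = tuple_of @: choices_family.
Proof.
apply/setP=> t; apply/idP/imsetP => [|[d dP ->]].
  rewrite inE => /andP[/star_relbP[t2 tm] /forallP tchi].
  have tE v : t v = if chi v then affdih_refl n ((val (t v)).1.2, (val (t v)).2.2) else 1%g.
    by rewrite -(eqP (tchi v)); apply: (affdih_involution L2 on); apply: t2.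
  have an v : (val (t v)).1.2 ^+ n.+1 = 1 by apply/eqP; exact: (valP (t v)).
  have a0 v : (val (t v)).1.2 != 0 by have /eqP/root_neq0 := an v.
  pose d := [ffun v => if chi v then
    if rt v == v then ((val (t v)).1.2, (val (t v)).2.2)
    else ((val (t (rt v))).1.2 / (val (t v)).1.2, (val (t v)).2.2 - (val (t (rt v))).2.2)
    else (1, 0)].
  exists d.
    rewrite inE; apply/forallP=> v; rewrite /choices ffunE.
    case: ifP => cv; last by rewrite inE.
    case: (eqVneq (rt v) v) => [rv|rv]; rewrite inE /= ?an //.
    have e := tm v rv; rewrite gpow_expg /= [t v]tE [t (rt v)]tE chi_rt cv in e.
    move/eqP: e; rewrite affdih_reflM ?mm_neq0 ?an //= => /andP[e1 /implyP H].
    apply/andP; split; first exact: e1.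
    by apply/implyP => /H; rewrite subr_eq0 eq_sym.
  apply/ffunP=> v; rewrite !ffunE [LHS]tE; case: ifP => // cv.
  case: (eqVneq (rt v) v) => rv; first by [].
  rewrite rtK eqxx chi_rt cv /=; congr (affdih_refl n (_, _)); last by rewrite addrC subrK.
  by rewrite invf_div mulrC divfK ?a0.
have nz w : (d w).1 != 0 by have /eqP/root_neq0 := choices_root w dP.
have un v : (if rt v == v then d v else ((d (rt v)).1 / (d v).1, (d (rt v)).2 + (d v).2)).1
    ^+ n.+1 = 1.
  by case: ifP => _; rewrite ?expr_div_n !(choices_root _ dP) ?divr1.
rewrite inE; apply/andP; split; last first.
  by apply/forallP=> v; rewrite ffunE; case: ifP => // _; rewrite val_affdih_refl.
apply/andP; split; apply/forallP=> v.
  by rewrite ffunE; case: ifP => _; rewrite ?mulg1 // affdih_refl2.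
apply/implyP=> rv; rewrite !ffunE chi_rt; case: ifP => cv; last by rewrite mulg1 expg1n.
have := dP; rewrite inE => /forallP/(_ v); rewrite /choices cv (negPf rv) inE => /andP[dm d1].
have un' := un v; rewrite (negPf rv) in un'.
rewrite rtK eqxx affdih_reflM ?mm_neq0 ?(choices_root _ dP) //=.
have -> : (d (rt v)).1 / ((d (rt v)).1 / (d v).1) = (d v).1.
  by field; rewrite !nz.
by rewrite dm; apply/implyP => /(implyP d1) /eqP->; rewrite addr0.
Qed.

Lemma card_tuples_over : #|tuples_over| =
  (\prod_(v | chi v) if rt v == v then n.+1 * #|L| else 1 + (mm v).-1 * #|L|)%N.
Proof.
rewrite tuple_of_image card_in_imset; last exact: tuple_of_inj.
have -> : #|choices_family| = #|family choices|.
  by apply: eq_card => d; rewrite inE; apply/forallP/familyP.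
rewrite card_family foldrE big_map big_enum /= [RHS]big_mkcond /=.
apply: eq_bigr => v _; rewrite /choices; case: ifP => _; last by rewrite cards1.
case: (eqVneq (rt v) v) => rv; last by rewrite (card_leaf_choices zP) ?mmn.
rewrite -[in RHS](card_unity_roots zP (dvdnn _)) -[#|L|]cardsT -cardsX.
by apply: eq_card => u; rewrite !inE andbT.
Qed.

End CountTuples.

Section LabelPolynomial.
Import Num.Theory.

Definition label_poly (s : seq nat) : {poly rat} := \prod_(m <- s) (1 + m.-1%:R *: 'X).

Lemma label_poly_nat (s : seq nat) (x : nat) :
  (label_poly s).[x%:R] = (\prod_(m <- s) (1 + m.-1 * x))%N%:R.
Proof.
rewrite /label_poly horner_prod natr_prod; apply: eq_bigr => m _.
by rewrite !hornerE natrD natrM.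
Qed.

Lemma label_poly_roots (s : seq nat) : all (leq 2) s ->
  label_poly s = (\prod_(m <- s) m.-1%:R) *: \prod_(r <- [seq - (m.-1%:R : rat)^-1 | m <- s]) ('X - r%:P).
Proof.
rewrite /label_poly; elim: s => [|m s IHs] /=; first by rewrite !big_nil scale1r.
case/andP=> m2 /IHs {}IHs; rewrite !big_cons IHs.
have m0 : m.-1%:R != 0 :> rat by rewrite pnatr_eq0; lia.
have -> : 1 + m.-1%:R *: 'X = m.-1%:R%:P * ('X - (- (m.-1%:R)^-1)%:P) :> {poly rat}.
  rewrite mulrBr -polyCM mulrN divff // polyCN polyC1 opprK addrC -mul_polyC.
  by [].
by rewrite -!mul_polyC polyCM; ring.
Qed.

(** The two polynomials agree at the infinitely many points [x j], hence coincide; their roots -1/(m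
    - 1), with multiplicity, give back the labels. *)
Lemma perm_eq_of_label_products (s t : seq nat) (x : nat -> nat) :
  all (leq 2) s -> all (leq 2) t -> injective x ->
  (forall j, \prod_(m <- s) (1 + m.-1 * x j) = \prod_(m <- t) (1 + m.-1 * x j))%N ->
  perm_eq s t.
Proof.
move=> s2 t2 xI st; have st_poly : label_poly s = label_poly t.
  apply/eqP; rewrite -subr_eq0; apply/negPn/negP => d0.
  have := max_poly_roots (rs := [seq (x j)%:R | j <- iota 0 (size (label_poly s - label_poly t))]) d0.
  rewrite size_map size_iota ltnn => H; apply: notF; apply: H.
    by apply/allP=> _ /mapP[j _ ->]; rewrite rootE hornerD hornerN !label_poly_nat st subrr.
  by rewrite map_inj_uniq ?iota_uniq // => i j /eqP; rewrite eqr_nat => /eqP/xI.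
have lc u : all (leq 2) u -> lead_coef (label_poly u) = \prod_(m <- u) m.-1%:R.
  move=> u2; rewrite label_poly_roots // lead_coefZ (monicP _) ?mulr1 //.
  exact: monic_prod_XsubC.
have nz u : all (leq 2) u -> \prod_(m <- u) m.-1%:R != 0 :> rat.
  move/allP=> u2; rewrite prodf_seq_neq0; apply/allP=> m /u2 m2 /=; rewrite pnatr_eq0; lia.
have cst : \prod_(m <- s) m.-1%:R = \prod_(m <- t) m.-1%:R :> rat.
  by rewrite -lc // -lc // st_poly.
have : perm_eq [seq - (m.-1%:R : rat)^-1 | m <- s] [seq - (m.-1%:R : rat)^-1 | m <- t].
  apply: prod_XsubC_eq; apply: (scalerI (nz s s2)).
  by rewrite -label_poly_roots // st_poly label_poly_roots // cst.
(* Labels are rewritten as [k.+2], because [m.-1] takes the same value at 0 and 1. *)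
have shift u : all (leq 2) u -> u = [seq k.+2 | k <- [seq (m - 2)%N | m <- u]].
  move/allP=> u2; rewrite -map_comp -[LHS]map_id; apply/eq_in_map => m /u2 m2 /=; lia.
rewrite (shift s s2) (shift t t2); move: (map _ s) (map _ t) => s' t'.
rewrite -!map_comp => /(perm_map_inj _) H; apply: perm_map; apply: H.
by move=> a b /= /oppr_inj/invr_inj/eqP; rewrite eqr_nat eqSS => /eqP.
Qed.

End LabelPolynomial.

Lemma perm_eq_bijection (S T : finType) (K : eqType) (f : S -> K) (g : T -> K) :
  perm_eq [seq f x | x <- enum S] [seq g y | y <- enum T] ->
  exists (b : S -> T) (b' : T -> S), [/\ cancel b b', cancel b' b & forall x, g (b x) = f x].
Proof.
move=> pe; have sz : #|S| = #|T| by rewrite !cardE -(size_map f) -(size_map g) (perm_size pe).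
have st : size [seq g y | y <- enum T] == #|T| by rewrite size_map -cardE.
have /tuple_permP[p ep] : perm_eq [seq f x | x <- enum S] (Tuple st) by [].
pose b x := enum_val (p (cast_ord sz (enum_rank x))).
exists b, (fun y => enum_val (cast_ord (esym sz) (p^-1%g (enum_rank y)))); split=> [x|y|x].
- by rewrite /b enum_valK permK cast_ordK enum_rankK.
- by rewrite /b enum_valK cast_ordKV permKV enum_rankK.
have := congr1 (fun u => nth (f x) u (cast_ord sz (enum_rank x))) ep.
rewrite -tnth_nth tnth_mktuple (tnth_nth (f x)) /= (nth_map x) -?cardE // nth_enum_rank => ->.
by rewrite (nth_map (b x)) -?cardE // -(enum_val_nth (b x)).
Qed.

Local Close Scope ring_scope.

(** * Matching the stars *)

Lemma transfer_sym (V V' : finType) (adj : rel V) m (adj' : rel V') m'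
    (C : forall gT : finGroupType, (V -> gT) -> (V' -> gT) -> Prop) :
  transfer adj m adj' m' C -> transfer adj' m' adj m (fun gT t' t => C gT t t').
Proof.
case=> r tl tr tf ti tn; split=> [gT t' t /r[] //|gT t /tr //|gT t /tl //|||].
- by move=> gT t u t' u' c c' e; apply: ti c c' e.
- by move=> gT t u t' u' c c' e; apply: tf c c' e.
- by move=> gT hT f t t' fM c; apply: tn.
Qed.

Section Characters.
Variables (V : finType) (rt : V -> V) (mm : V -> nat).
Hypothesis rtK : forall v, rt (rt v) = rt v.
Hypothesis mmP : forall v, rt v != v -> odd (mm v) /\ 1 < mm v.

Lemma star_character (chi : V -> 'Z_2) :
  fin_rel (star_adj rt) (star_label rt mm) chi <-> forall v, chi (rt v) = chi v.
Proof.
split=> [/star_relP-/(_ rtK)[c2 cm] v|crt].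
  have [-> //|rv] := eqVneq (rt v) v; have := cm v rv; rewrite gpow_expg /=.
  have [om _] := mmP rv; rewrite -(odd_double_half (mm v)) om -muln2 mulnC expgD expgM.
  have -> : ((chi (rt v) * chi v) ^+ 2 = 1 :> 'Z_2)%g.
    by case: (Z2_cases (chi (rt v) * chi v)%g) => ->; apply: val_inj.
  by rewrite expg1n mulg1; case: (Z2_cases (chi (rt v))) (Z2_cases (chi v)) => -> [] ->.
apply/star_relP=> //; have cc x : (x * x = 1 :> 'Z_2)%g.
  by case: (Z2_cases x) => ->; apply: val_inj.
by split=> v *; [exact: cc | rewrite gpow_expg /= crt cc expg1n].
Qed.

Definition star_char (r : V) : V -> 'Z_2 := fun v => if rt v == r then sgn1 else 1%g.

Lemma star_char_rel r : fin_rel (star_adj rt) (star_label rt mm) (star_char r).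
Proof. by apply/star_character => v; rewrite /star_char rtK. Qed.

End Characters.

Section Weight.
Variables (V : finType) (rt : V -> V) (mm : V -> nat).
Hypothesis rtK : forall v, rt (rt v) = rt v.
Variables (L : finFieldType) (N p e : nat) (z : L).
Hypotheses (pp : prime p) (oN : odd N) (Np : coprime N p).
Hypothesis mmN : forall v, rt v != v -> mm v %| N.
Hypotheses (L2 : (2%:R != 0 :> L)%R) (zP : N.-primitive_root%R z).
Hypotheses (e0 : 0 < e) (cL : #|L| = p ^ e).
Variable chi : V -> 'Z_2.
Hypothesis chi_rt : forall v, chi (rt v) = chi v.

Definition weight := #|[pred v | (chi v == sgn1) && (rt v == v)]|.
Definition leaf_product := \prod_(v | (chi v == sgn1) && (rt v != v)) (1 + (mm v).-1 * #|L|).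

Lemma card_tuples_weight :
  #|tuples_over rt mm L N.-1 (fun v => chi v == sgn1)| = (N * #|L|) ^ weight * leaf_product.
Proof.
have NE : N.-1.+1 = N by rewrite prednK // odd_gt0.
rewrite (card_tuples_over rtK (z := z)) ?NE //; last by move=> v; rewrite chi_rt.
rewrite (bigID (fun v => rt v == v)) /=; congr (_ * _).
  rewrite -prod_nat_const; apply: eq_big => [v|v /andP[_ ->]] //.
by apply: eq_bigr => v /andP[_ /negPf ->].
Qed.

(* The number of stars on which [chi] is nontrivial is a [p]-adic valuation. *)
Lemma logn_card_tuples :
  logn p #|tuples_over rt mm L N.-1 (fun v => chi v == sgn1)| = weight * e.
Proof.
have lp0 : 0 < leaf_product by apply: prodn_gt0.
have N0 : 0 < N by apply: odd_gt0.
have L0 : 0 < #|L| by rewrite cL expn_gt0 prime_gt0.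
rewrite card_tuples_weight lognM ?expn_gt0 ?muln_gt0 ?N0 ?L0 // lognX lognM // cL pfactorK //.
rewrite (logn_coprime (m := N)) ?add0n 1?coprime_sym // (logn_coprime (m := leaf_product)) ?addn0 //.
rewrite coprime_sym /leaf_product; elim/big_ind: _ => [|x y cx cy|v _]; rewrite ?coprime1n //.
  by rewrite coprimeMl cx.
rewrite coprime_sym prime_coprime // cL -(prednK e0) expnS mulnCA dvdn_addl ?dvdn_mulr //.
by rewrite dvdn1; apply: contraL pp => /eqP->.
Qed.

End Weight.

(** The transfer is injective on tuples, and by naturality for [affdih_sign] it maps tuples over
    [chi] to tuples over [chi']. *)
Lemma leq_card_tuples (V : finType) (rt : V -> V) (mm : V -> nat)
    (V' : finType) (rt' : V' -> V') (mm' : V' -> nat)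
    (C : forall gT : finGroupType, (V -> gT) -> (V' -> gT) -> Prop)
    (L : finFieldType) n (chi : V -> 'Z_2) (chi' : V' -> 'Z_2) :
  (forall v, rt (rt v) = rt v) -> (forall v, rt' (rt' v) = rt' v) ->
  transfer (star_adj rt) (star_label rt mm) (star_adj rt') (star_label rt' mm') C ->
  C _ chi chi' ->
  #|tuples_over rt mm L n (fun v => chi v == sgn1)| <=
    #|tuples_over rt' mm' L n (fun v => chi' v == sgn1)|.
Proof.
move=> rtK rtK' tC Cchi; set A := tuples_over _ _ _ _ _; set A' := tuples_over _ _ _ _ _.
have signE (b : bool) (x : 'Z_2) : ((if b then sgn1 else 1%g) == x) = (b == (x == sgn1)).
  by case: b; case: (Z2_cases x) => ->.
have /fin_all_exists[g gP] (t : {ffun V -> affdih L n}) :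
    exists t' : {ffun V' -> affdih L n}, t \in A ->
      t' \in A' /\ exists2 t1, C _ (t : V -> affdih L n) t1 & t1 =1 t'.
  case: (boolP (t \in A)) => [|_]; last by exists [ffun=> 1%g].
  rewrite inE => /andP[/star_relbP/(star_relP mm rtK) Rt /forallP tchi].
  have [t1 Ct1] := transfer_l tC Rt; exists [ffun v => t1 v] => _.
  have [_ /(star_relP mm' rtK')[r1 r2]] := transfer_rel tC Ct1.
  split; last by exists t1 => // v; rewrite ffunE.
  rewrite inE; apply/andP; split.
    apply/star_relbP; split=> v *; rewrite !ffunE; [exact: r1 | exact: r2].
  apply/forallP=> v; rewrite ffunE -signE; apply/eqP.
  apply: (transfer_fun tC (transfer_nat tC (@affdih_signM L n) Ct1) Cchi) => w /=.
  by apply/eqP; rewrite signE.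
rewrite -(card_in_imset (f := g) (D := A)).
  by apply: subset_leq_card; apply/subsetP => _ /imsetP[t /gP[tA' _] ->].
move=> t u /gP[_ [t1 Ct1 e1]] /gP[_ [u1 Cu1 e2]] e; apply/ffunP => v.
by apply: (transfer_inj tC Ct1 Cu1) => w; rewrite e1 e2 e.
Qed.

Section Matching.
Variables (V : finType) (rt : V -> V) (mm : V -> nat).
Hypothesis rtK : forall v, rt (rt v) = rt v.
Hypothesis mmP : forall v, rt v != v -> odd (mm v) /\ 1 < mm v.
Variables (V' : finType) (rt' : V' -> V') (mm' : V' -> nat).
Hypothesis rtK' : forall v, rt' (rt' v) = rt' v.
Hypothesis mmP' : forall v, rt' v != v -> odd (mm' v) /\ 1 < mm' v.
Variable C : forall gT : finGroupType, (V -> gT) -> (V' -> gT) -> Prop.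
Hypothesis tC : transfer (star_adj rt) (star_label rt mm) (star_adj rt') (star_label rt' mm') C.

Definition star_leaves r := [seq mm v | v <- enum V & (rt v == r) && (rt v != v)].

Let tC' := transfer_sym tC.

Lemma card_transfer (L : finFieldType) n (chi : V -> 'Z_2) (chi' : V' -> 'Z_2) :
  C chi chi' ->
  #|tuples_over rt mm L n (fun v => chi v == sgn1)| =
    #|tuples_over rt' mm' L n (fun v => chi' v == sgn1)|.
Proof.
move=> c; apply/eqP; rewrite eqn_leq (leq_card_tuples L n rtK rtK' tC c).
exact: (leq_card_tuples L n rtK' rtK tC' c).
Qed.

Definition common_multiple :=
  (3 * (\prod_(v | rt v != v) mm v * \prod_(v | rt' v != v) mm' v))%N.

Lemma odd_common_multiple : odd common_multiple.
Proof.
by rewrite /common_multiple !oddM /=; apply/andP; split;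
  elim/big_ind: _ => // [x y ox oy|v rv]; rewrite ?oddM ?ox //;
  [case: (mmP rv) | case: (mmP' rv)].
Qed.

Lemma dvdn_common_multiple v : rt v != v -> mm v %| common_multiple.
Proof. by move=> rv; rewrite dvdn_mull // dvdn_mulr // (bigD1 v) //= dvdn_mulr. Qed.

Lemma dvdn_common_multiple' v : rt' v != v -> mm' v %| common_multiple.
Proof. by move=> rv; rewrite dvdn_mull // dvdn_mull // (bigD1 v) //= dvdn_mulr. Qed.

Lemma leaf_product_star (L : finFieldType) r (chi : V -> 'Z_2) :
  chi =1 star_char rt r ->
  leaf_product rt mm L chi = \prod_(k <- star_leaves r) (1 + k.-1 * #|L|).
Proof.
move=> chiE; rewrite /leaf_product /star_leaves big_map big_filter big_enum_cond /=.
by apply: eq_bigl => v; rewrite chiE /star_char; case: (rt v == r).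
Qed.

End Matching.

(** By the [p]-adic valuation of the counts, the partner of a one-star character is again supported
    on one star. Cancelling the common factor N * |L| leaves the leaf products at |L|, and letting
    [L] vary determines the labels. *)
Lemma match_roots (V : finType) (rt : V -> V) (mm : V -> nat)
    (V' : finType) (rt' : V' -> V') (mm' : V' -> nat)
    (C : forall gT : finGroupType, (V -> gT) -> (V' -> gT) -> Prop) :
  (forall v, rt (rt v) = rt v) -> (forall v, rt v != v -> odd (mm v) /\ 1 < mm v) ->
  (forall v, rt' (rt' v) = rt' v) -> (forall v, rt' v != v -> odd (mm' v) /\ 1 < mm' v) ->
  transfer (star_adj rt) (star_label rt mm) (star_adj rt') (star_label rt' mm') C ->
  forall r, rt r = r -> exists r', [/\ rt' r' = r',
    exists2 chi' : V' -> 'Z_2, C _ (star_char rt r) chi' & chi' =1 star_char rt' r' &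
    perm_eq (star_leaves rt mm r) (star_leaves rt' mm' r')].
Proof.
move=> rtK mmP rtK' mmP' tC r rr.
have [chi' Cchi] := transfer_l tC (star_char_rel rtK mmP r).
have [/(star_character rtK mmP) chi_rt /(star_character rtK' mmP') chi'_rt] := transfer_rel tC Cchi.
pose N := common_multiple rt mm rt' mm'.
have oN : odd N by apply: odd_common_multiple.
have N0 := odd_gt0 oN.
have [p [pp op cop]] := prime_coprime_above N0.
have Np : coprime N p by apply: coprime_dvdl cop; rewrite dvdn_mull.
have mmN v : rt v != v -> mm v %| N by apply: dvdn_common_multiple.
have mmN' v : rt' v != v -> mm' v %| N by apply: dvdn_common_multiple'.
have fields j : exists L : finFieldType, [/\ (2%:R != 0 :> L)%R,
    #|L| = p ^ (totient N * j.+1) & exists z : L, (N.-primitive_root z)%R].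
  have [L [pL cL zL]] := finfield_of_order pp N0 Np (ltn0Sn j); exists L; split=> //.
  by rewrite -(dvdn_pcharf pL) dvdn_prime2 //; apply/eqP => p2; rewrite p2 in op.
have e0 j : 0 < totient N * j.+1 by rewrite muln_gt0 totient_gt0 N0.
have weightE : weight rt (star_char rt r) = weight rt' chi'.
  have [L [L2 cL [z zP]]] := fields 0.
  have l1 := logn_card_tuples rtK pp oN Np mmN L2 zP (e0 0) cL chi_rt.
  have l2 := logn_card_tuples rtK' pp oN Np mmN' L2 zP (e0 0) cL chi'_rt.
  apply/eqP; rewrite -(eqn_pmul2r (e0 0)) -l1 -l2; apply/eqP; congr logn.
  exact: (card_transfer rtK rtK' tC).
have weight1 : weight rt (star_char rt r) = 1.
  rewrite -[RHS](card1 r); apply: eq_card => v; rewrite !inE /star_char.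
  case: (eqVneq v r) => [->|vr]; first by rewrite rr !eqxx.
  by case: (rt v =P r) => [->|_]; [rewrite eqxx eq_sym (negPf vr) | ].
have [r' r'P] := mem_card1 (etrans (esym weightE) weight1).
have [chi'r rr'] : chi' r' = sgn1 /\ rt' r' = r'.
  by have := r'P r'; rewrite !inE eqxx => /andP[/eqP -> /eqP].
have chi'E : chi' =1 star_char rt' r'.
  move=> v; rewrite /star_char -chi'_rt; have := r'P (rt' v); rewrite !inE rtK' eqxx andbT => <-.
  by case: (Z2_cases (chi' (rt' v))) => ->.
exists r'; split=> //; first by exists chi'.
apply: (perm_eq_of_label_products (x := fun j => p ^ (totient N * j.+1))).
- apply/allP=> _ /mapP[v + ->]; rewrite mem_filter => /andP[/andP[_ /mmP[]]] //.
- apply/allP=> _ /mapP[v + ->]; rewrite mem_filter => /andP[/andP[_ /mmP'[]]] //.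
- by move=> i j /eqP; rewrite eqn_exp2l ?prime_gt1 // eqn_pmul2l ?totient_gt0 // => /eqP[].
move=> j; have [L [L2 cL [z zP]]] := fields j.
have := card_transfer rtK rtK' tC L N.-1 Cchi.
rewrite (card_tuples_weight rtK oN mmN L2 zP chi_rt).
rewrite (card_tuples_weight rtK' oN mmN' L2 zP chi'_rt) -weightE weight1 expn1 -cL.
rewrite (leaf_product_star mm L (r := r)) // (leaf_product_star mm' L chi'E) => /eqP.
rewrite eqn_pmul2l => [/eqP //|]; rewrite muln_gt0 N0 /=; apply/card_gt0P; by exists 0%R.
Qed.

(** Key 0 marks the centre; labels exceed 1, so no leaf has it. *)
Lemma count_star_key (V : finType) (rt : V -> V) (mm : V -> nat) r j :
  (forall v, rt (rt v) = rt v) -> (forall v, rt v != v -> odd (mm v) /\ 1 < mm v) -> rt r = r ->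
  count (fun v => (rt v == r) && ((if rt v == v then 0 else mm v) == j)) (enum V) =
  if j is 0 then 1 else count_mem j (star_leaves rt mm r).
Proof.
move=> rtK mmP rr; case: j => [|j].
  rewrite -(card1 r) -size_filter cardE enumT; congr size; apply: eq_filter => v /=.
  rewrite !inE; case: (eqVneq v r) => [->|vr]; first by rewrite rr !eqxx.
  case: (eqVneq (rt v) v) => [e|rv]; first by rewrite e (negPf vr).
  by have [_ m1] := mmP v rv; rewrite [mm v == 0]gtn_eqF ?andbF // ltnW.
rewrite /star_leaves [RHS]count_map [RHS]count_filter; apply: eq_count => v /=.
by case: (rt v == v); rewrite /= ?andbF ?andbT // andbC.
Qed.

(** The map [sg] on centres is injective because characters separate stars, and surjective by the
    reverse transfer. Giving each vertex its target centre and label as a key turns the matching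
    into an equality of multisets. *)
Lemma star_bijection (V : finType) (rt : V -> V) (mm : V -> nat)
    (V' : finType) (rt' : V' -> V') (mm' : V' -> nat)
    (C : forall gT : finGroupType, (V -> gT) -> (V' -> gT) -> Prop) :
  (forall v, rt (rt v) = rt v) -> (forall v, rt v != v -> odd (mm v) /\ 1 < mm v) ->
  (forall v, rt' (rt' v) = rt' v) -> (forall v, rt' v != v -> odd (mm' v) /\ 1 < mm' v) ->
  transfer (star_adj rt) (star_label rt mm) (star_adj rt') (star_label rt' mm') C ->
  exists (b : V -> V') (b' : V' -> V), [/\ cancel b b', cancel b' b,
    forall v, rt' (b v) = b (rt v) & forall v, rt v != v -> mm' (b v) = mm v].
Proof.
move=> rtK mmP rtK' mmP' tC.
have /fin_all_exists[sg sgP] r : exists r', rt r = r -> [/\ rt' r' = r',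
    exists2 chi' : V' -> 'Z_2, C _ (star_char rt r) chi' & chi' =1 star_char rt' r' &
    perm_eq (star_leaves rt mm r) (star_leaves rt' mm' r')].
  have [rr|rr] := eqVneq (rt r) r.
    by have [r' r'P] := match_roots rtK mmP rtK' mmP' tC rr; exists r'.
  have [r' _] := match_roots rtK mmP rtK' mmP' tC (rtK r).
  by exists r' => e; rewrite e eqxx in rr.
have sg_root r : rt r = r -> rt' (sg r) = sg r by case/sgP.
have char_inj (W : finType) (q : W -> W) r s : q s = s -> star_char q r =1 star_char q s -> r = s.
  by move=> qs /(_ s); rewrite /star_char qs eqxx; case: eqP.
have sg_inj r s : rt r = r -> rt s = s -> sg r = sg s -> r = s.
  move=> rr ss e; have [_ [c cC cE] _] := sgP r rr; have [_ [d dC dE] _] := sgP s ss.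
  apply: (char_inj _ rt) => //; apply: (transfer_inj tC cC dC) => v.
  by rewrite cE dE e.
have sg_surj r' : rt' r' = r' -> exists2 r, rt r = r & sg r = r'.
  move=> rr'; have [r [rr [c cC cE] _]] := match_roots rtK' mmP' rtK mmP (transfer_sym tC) rr'.
  exists r => //; have [srr [d dC dE] _] := sgP r rr.
  apply: (char_inj _ rt') => // v.
  rewrite -dE; apply: (transfer_fun tC dC cC) => w; exact/esym/cE.
pose key v := (sg (rt v), if rt v == v then 0 else mm v).
pose key' v := (rt' v, if rt' v == v then 0 else mm' v).
have pe : perm_eq [seq key v | v <- enum V] [seq key' v | v <- enum V'].
  rewrite /perm_eq; apply/allP=> -[r' j] _; apply/eqP; rewrite [LHS]count_map [RHS]count_map.
  have [rr'|rr'] := eqVneq (rt' r') r'; last first.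
    have no0 (T : Type) (P : pred T) (s : seq T) : P =1 pred0 -> count P s = 0.
      by move=> P0; rewrite (eq_count P0) count_pred0.
    rewrite !no0 // => v /=; rewrite xpair_eqE; case: eqP => //= e.
      by rewrite -e rtK' eqxx in rr'.
    by rewrite -e sg_root ?rtK ?eqxx in rr'.
  have [r rr sgr] := sg_surj r' rr'; have [_ _ /seq.permP pl] := sgP r rr.
  transitivity (count (fun v => (rt v == r) && ((if rt v == v then 0 else mm v) == j)) (enum V)).
    apply: eq_count => v /=; rewrite xpair_eqE -sgr; congr (_ && _).
    by apply/eqP/eqP => [|-> //]; apply: sg_inj.
  rewrite count_star_key // (eq_count (a2 := fun v =>
    (rt' v == r') && ((if rt' v == v then 0 else mm' v) == j))) ?count_star_key //.
  by rewrite -sgr pl.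
have [b [b' [bK b'K bkey]]] := perm_eq_bijection pe.
have root_b v : (rt' (b v) == b v) = (rt v == v).
  have := congr1 snd (bkey v); rewrite /key /key' /=.
  case: eqVneq => [_|rb]; case: eqVneq => [_|rv] //= e.
    by have [_] := mmP v rv; rewrite -e.
  by have [_] := mmP' _ rb; rewrite e.
have rt_b v : rt' (b v) = sg (rt v) by have := congr1 fst (bkey v).
have b_root v : rt v = v -> b v = sg v.
  by move=> rv; move: (root_b v); rewrite rt_b rv eqxx => /eqP.
exists b, b'; split=> // v.
  by rewrite rt_b b_root.
move=> rv; have := congr1 snd (bkey v); rewrite /key /key' /=.
by rewrite root_b (negPf rv).
Qed.

Lemma star_presentation_hom (V : finType) (rt : V -> V) (mm : V -> nat) (G : Grp) (s : V -> G)
    (V' : finType) (rt' : V' -> V') (mm' : V' -> nat) (G' : Grp) (s' : V' -> G') (b : V -> V') :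
  (forall v, rt (rt v) = rt v) -> (forall v, rt' (rt' v) = rt' v) ->
  coxeter_presentation (star_adj rt) (star_label rt mm) s ->
  coxeter_presentation (star_adj rt') (star_label rt' mm') s' ->
  injective b -> (forall v, rt' (b v) = b (rt v)) -> (forall v, rt v != v -> mm' (b v) = mm v) ->
  exists2 f : G -> G', is_hom f & forall v, f (s v) = s' (b v).
Proof.
move=> rtK rtK' [_ [_ univ]] [/(star_relP mm' rtK')[s2 sm] _] bI brt bmm.
have [|f [fM fs]] := univ G' (s' \o b); last by exists f.
apply/star_relP => //; split=> v /=; first exact: s2.
by move=> rv; rewrite -brt -bmm // sm // brt (inj_eq bI).
Qed.

Lemma star_presentation_iso (V : finType) (rt : V -> V) (mm : V -> nat) (G : Grp) (s : V -> G)
    (V' : finType) (rt' : V' -> V') (mm' : V' -> nat) (G' : Grp) (s' : V' -> G')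
    (b : V -> V') (b' : V' -> V) :
  (forall v, rt (rt v) = rt v) -> (forall v, rt' (rt' v) = rt' v) ->
  coxeter_presentation (star_adj rt) (star_label rt mm) s ->
  coxeter_presentation (star_adj rt') (star_label rt' mm') s' ->
  cancel b b' -> cancel b' b ->
  (forall v, rt' (b v) = b (rt v)) -> (forall v, rt v != v -> mm' (b v) = mm v) ->
  grp_iso G' G.
Proof.
move=> rtK rtK' Ps Ps' bK b'K brt bmm.
have b'rt v : rt (b' v) = b' (rt' v) by rewrite -{2}(b'K v) brt bK.
have b'mm v : rt' v != v -> mm (b' v) = mm' v.
  by move=> rv; rewrite -{2}(b'K v) bmm // b'rt (inj_eq (can_inj b'K)).
have [f fM fs] := star_presentation_hom rtK rtK' Ps Ps' (can_inj bK) brt bmm.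
have [g gM gs] := star_presentation_hom rtK' rtK Ps' Ps (can_inj b'K) b'rt b'mm.
exists g, f; split=> //; split=> //; split=> x.
  by apply: (hom_gen_eq Ps' (f := f \o g) (f' := id)) => [y z|//|v] /=; rewrite ?gM ?fM // gs fs b'K.
by apply: (hom_gen_eq Ps (f := g \o f) (f' := id)) => [y z|//|v] /=; rewrite ?fM ?gM // fs gs bK.
Qed.

Theorem theorem9p10 (V : finType) (adj : rel V) (m : V -> V -> nat)
    (WG : Grp) (W : Grp) :
  coxeter_graph adj m -> forest adj -> odd_labels adj m ->
  is_W adj m WG ->
  coxeter_group W -> compl_iso W WG ->
  grp_iso W WG.
Proof.
move=> gr fo om isW [V' [adj' [m' [gr' isW']]]] [F [K [hF [hK [FK KF]]]]].
have ci : compl_iso WG W by exists K, F.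
have [rt [mm [rtK mmP [s Ps]]]] := star_presentation_of_forest gr fo om isW.
have [s0 Ps0] := isW'.
(* The transfer is taken twice: first for the given presentation of [W], to show that its graph is a
   forest with odd labels, then for the star presentation this allows. *)
have [C0 tC0] := transfer_compl_iso Ps Ps0 ci.
have odd_mm v : rt v != v -> odd (mm v) by case/mmP.
have om' := transfer_odd_labels rtK odd_mm tC0 gr'.
have fo' := transfer_forest rtK odd_mm tC0 gr'.
have [rt' [mm' [rtK' mmP' [s' Ps']]]] := star_presentation_of_forest gr' fo' om' isW'.
have [C tC] := transfer_compl_iso Ps Ps' ci.
have [b [b' [bK b'K brt bmm]]] := star_bijection rtK mmP rtK' mmP' tC.
exact: star_presentation_iso rtK rtK' Ps Ps' bK b'K brt bmm.
Qed.
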